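(* Let $n\geq 2$, $M\geq 3$ and $0\leq y\leq n$ be integers. Then $(n-y,y)\in\mathrm{HWP}(C_M[n];M,Mn)$, except possibly when at least one of the following holds: (1) $y=1$ and it is not the case that ($n=2$ and $M$ is odd); (2) $y=2<n$, $n\equiv 2\pmod 4$ and $M$ is odd; (3) $(y,n)\in\{(0,2),(0,6)\}$ and $M$ is odd.
   Context: $C_M[n]$ denotes the lexicographic product of the $M$-cycle with the empty graph on $n$ vertices: vertex set $\mathbb Z_M\times\mathbb Z_n$, with $(i,x)(j,y)$ an edge iff $j-i\equiv\pm1\pmod M$. A $C_k$-factor of a graph $G$ is a spanning subgraph of $G$ all of whose components are cycles of length $k$. For a graph $G$ and integers $M,N\ge3$, $\mathrm{HWP}(G;M,N)$ is the set of pairs $(\alpha,\beta)$ of nonnegative integers such that $G$ admits a set of $\alpha$ $C_M$-factors and $\beta$ $C_N$-factors whose edge sets partition $E(G)$. *)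

(* Defs.v *)
From mathcomp Require Import all_boot.
Set Implicit Arguments. Unset Strict Implicit. Unset Printing Implicit Defensive.

(* Graphs are given by an adjacency relation on a finite vertex type;
   edge sets of spanning subgraphs are given by (symmetric) relations. *)

Definition lexC (M n : nat) : rel ('I_M * 'I_n) :=
  fun u v => ((u.1 : nat).+1 %% M == v.1) || ((v.1 : nat).+1 %% M == u.1).

Arguments lexC : clear implicits.

Definition cyc_adj (T : eqType) (c : seq T) (x y : T) : bool :=
  (y == next c x) || (x == next c y).

(* F is (the edge set of) a C_k-factor of G: a spanning subgraph of G in which
   the component of every vertex v is a cycle of length k, i.e. there is a
   list c of k distinct vertices containing v such that the F-edges at the
   vertices of c are exactly the consecutive (cyclic) pairs of c. *)
Definition is_Ck_factor (T : finType) (G : rel T) (k : nat) (F : rel T) : Prop :=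
  [/\ symmetric F,
      (forall x y, F x y -> G x y) &
      forall v : T, exists c : seq T,
        [/\ size c = k, uniq c, v \in c &
            forall x y, x \in c -> F x y = cyc_adj c x y]].

(* (a, b) \in HWP(G; M, N): a C_M-factors and b C_N-factors (indexed by
   'I_(a+b), the first a being the C_M-factors) partitioning E(G):
   each edge lies in exactly one factor, each non-edge in none. *)
Definition HWP (T : finType) (G : rel T) (M N : nat) (a b : nat) : Prop :=
  exists F : 'I_(a + b) -> rel T,
    (forall i : 'I_(a + b), is_Ck_factor G (if (i : nat) < a then M else N) (F i)) /\
    (forall x y : T, #|[set i | F i x y]| = nat_of_bool (G x y)).

(* Main.v *)
Require Import Defs.
From mathcomp Require Import all_boot ssralg zmodp zify.
Set Implicit Arguments. Unset Strict Implicit. Unset Printing Implicit Defensive.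

(* A family of permutations s_{k,i} of Z_n (rows k, layers i), sharply transitive
   in each layer, splits C_M[n] into the 2-factors F_k with edges
   (i, x)(i+1, s_{k,i} x); the cycles of F_k have M times the lengths of the
   cycles of the product of its row. With translations s_{k,i} = x + c_i(k), the
   factor F_k is a C_M-factor if its row sum is 0 and a Hamiltonian cycle if it is
   a unit modulo n, so explicit matrices whose columns are permutations of Z_n
   settle every y of the right parity.

   For n even and y of the other parity, one row sum is -2, giving a factor with
   two cycles. If this row and a unit row have the same odd difference in two
   consecutive columns, there is a 4-cycle around one layer alternating between
   the two factors; exchanging its edges is a 2-opt move on each of them, which
   keeps the Hamiltonian cycle Hamiltonian and merges the two cycles of the other.

   For y = 0 with M odd and n even, the rows come from a transversal design
   TD(4, n), that is, a pair of orthogonal Latin squares. Write n = 3 t + u with t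
   coprime to 6 and u odd, u <= t, and apply Wilson's construction; this leaves
   only products and the orders 4, 8, 10, 14, given by quasi-difference matrices. *)

(** * Cycle factors given by permutations *)

Section StepFactor.
Variables (T : finType) (f : T -> T).
Hypothesis f_inj : injective f.

Definition step_rel : rel T := fun x y => (y == f x) || (x == f y).

Lemma step_rel_sym : symmetric step_rel.
Proof. by move=> x y; rewrite /step_rel orbC. Qed.

Lemma next_orbit v x : x \in orbit f v -> next (orbit f v) x = f x.
Proof.
by move=> xv; have /eqP := next_cycle (cycle_orbit f_inj v) xv.
Qed.

Lemma step_rel_cyc_adj v x y :
  x \in orbit f v -> step_rel x y = cyc_adj (orbit f v) x y.
Proof.
move=> xv; rewrite /step_rel /cyc_adj next_orbit //; congr (_ || _).
case: (boolP (y \in orbit f v)) => yv; first by rewrite next_orbit.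
rewrite next_nth (negPf yv).
have -> : (x == y) = false by apply/eqP => xy; rewrite -xy xv in yv.
apply/eqP => xy; case/negP: yv; move: xv; rewrite -!fconnect_orbit xy.
by rewrite -same_fconnect1_r.
Qed.

Lemma step_rel_factor (G : rel T) k :
  (forall x, G x (f x)) -> symmetric G -> (forall v, order f v = k) ->
  is_Ck_factor G k step_rel.
Proof.
move=> Gf Gs ford; split; first exact: step_rel_sym.
  by move=> x y /orP [] /eqP ->; rewrite // Gs.
move=> v; exists (orbit f v); split; first by rewrite size_orbit.
- exact: orbit_uniq.
- exact: in_orbit.
- by move=> x y; exact: step_rel_cyc_adj.
Qed.

Lemma order_le_iter v m : 0 < m -> iter m f v = v -> order f v <= m.
Proof.
move=> m0 fm; rewrite leqNgt; apply/negP => lt_m.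
have := orbit_uniq f v; rewrite /orbit => /(@uniqP _ v) /(_ m 0).
rewrite !inE size_traject !nth_traject ?order_gt0 //= fm.
by rewrite lt_m => /(_ isT isT erefl) m00; rewrite m00 in m0.
Qed.

End StepFactor.

Lemma uniq_full (T : finType) (c : seq T) x :
  uniq c -> #|T| <= size c -> x \in c.
Proof.
move=> Uc sc; apply/negPn/negP => nx.
have /card_uniqP e : uniq (x :: c) by rewrite /= nx.
by have := max_card (mem (x :: c)); rewrite e /= ltnNge sc.
Qed.

(** Along a cycle of length above 2 each vertex already has two distinct neighbours, its successor
    and its predecessor, so the degree bound leaves no room for chords. *)
Lemma cyc_adj_of_degree2 (T : finType) (c : seq T) (F : rel T) (n1 n2 : T -> T) :
  symmetric F -> (forall x y, F x y -> (y == n1 x) || (y == n2 x)) ->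
  cycle F c -> uniq c -> 2 < size c -> (forall x, x \in c) ->
  forall x y, F x y = cyc_adj c x y.
Proof.
move=> Fs Fd Fc Uc sc inc x y.
have Fn a : F a (next c a) := next_cycle Fc (inc a).
have Fp a : F a (prev c a) by rewrite Fs; apply: prev_cycle.
have np a : next c a != prev c a.
  apply/eqP => e.
  have nn : iter 2 (next c) a = a by rewrite /= e next_prev.
  have := order_le_iter (m := 2) isT nn.
  by rewrite (order_cycle (cycle_next Uc) Uc (inc a)) leqNgt sc.
apply/idP/orP.
- move=> Fxy.
  have e1 := Fd _ _ Fxy; have e2 := Fd _ _ (Fn x); have e3 := Fd _ _ (Fp x).
  have : (y == next c x) || (y == prev c x).
    move: (np x) e1 e2 e3; case/orP: (Fd _ _ Fxy) => _ nn.
    by move=> /orP[]/eqP e1 /orP[]/eqP e2 /orP[]/eqP e3;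
       rewrite ?e1 ?e2 ?e3 ?eqxx ?orbT //; rewrite e2 e3 eqxx in nn.
    by move=> /orP[]/eqP e1 /orP[]/eqP e2 /orP[]/eqP e3;
       rewrite ?e1 ?e2 ?e3 ?eqxx ?orbT //; rewrite e2 e3 eqxx in nn.
  case/orP => /eqP ->; [by left|right].
  by rewrite next_prev.
- by case=> /eqP ->; rewrite // Fs.
Qed.

(** * The 2-opt move on step relations *)

Section TwoOpt.
Variables (T : finType) (f : T -> T).
Hypothesis f_inj : injective f.
Variables u z : T.
Let w := f u.
Let t := f z.

(** The edges uw and zt give way to uz and wt; [opt_out] and [opt_in] are the two neighbours of x
    afterwards. They are not inverse to each other: [opt_out] exchanges u and z, [opt_in] exchanges
    w and t, because one of the two arcs will be traversed backwards. *)
Definition opt_out x := if x == u then z else if x == z then u else f x.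
Definition opt_in x := if x == w then t else if x == t then w else finv f x.
Definition opt_rel : rel T := fun x y => (y == opt_out x) || (y == opt_in x).

Hypothesis nuz : u != z.

Let nwt : w != t. Proof. by rewrite /w /t (inj_eq f_inj). Qed.

Lemma opt_rel_step x : x != u -> x != z -> opt_rel x (f x).
Proof. by move=> /negPf xu /negPf xz; rewrite /opt_rel /opt_out xu xz eqxx. Qed.

Lemma opt_rel_sym : symmetric opt_rel.
Proof.
suff H x y : opt_rel x y -> opt_rel y x by move=> x y; apply/idP/idP; exact: H.
case/orP => /eqP ->; rewrite /opt_rel.
  rewrite /opt_out; have [->|xu] := eqVneq x u.
    by rewrite [z == u]eq_sym (negPf nuz) !eqxx.
  have [->|xz] := eqVneq x z; first by rewrite !eqxx.
  by rewrite /opt_in !(inj_eq f_inj) (negPf xu) (negPf xz) finv_f // eqxx orbT.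
rewrite /opt_in; have [->|xw] := eqVneq x w.
  by rewrite [t == w]eq_sym (negPf nwt) !eqxx orbT.
have [->|xt] := eqVneq x t; first by rewrite !eqxx orbT.
have nu : finv f x != u by apply: contra xw => /eqP xu; rewrite /w -xu f_finv.
have nz : finv f x != z by apply: contra xt => /eqP xz; rewrite /t -xz f_finv.
by rewrite /opt_out (negPf nu) (negPf nz) f_finv ?eqxx.
Qed.

Lemma opt_rel_uz : opt_rel u z.
Proof. by rewrite /opt_rel /opt_out !eqxx. Qed.

Lemma opt_rel_wt : opt_rel w t.
Proof. by rewrite /opt_rel /opt_in !eqxx orbT. Qed.

Lemma opt_rel_path x p :
  fpath f x p -> (forall y, y \in belast x p -> y != u /\ y != z) ->
  path opt_rel x p.
Proof.
elim: p x => //= y p IH x /andP [/eqP <- fp] Hp.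
have [xu xz] := Hp x (mem_head _ _); rewrite opt_rel_step //=.
by apply: IH => // a ain; apply: Hp; rewrite inE ain orbT.
Qed.

(** The arcs starting at w and t are glued by running through the second one backwards: uz joins
    their ends and tw closes the cycle. The first alternative describes one cycle cut at both edges,
    the second one two cycles cut once each. *)
Lemma opt_rel_cycle p1 p2 :
  fpath f w p1 -> fpath f t p2 -> uniq ((w :: p1) ++ (t :: p2)) ->
  (last w p1 = z /\ last t p2 = u) \/ (last w p1 = u /\ last t p2 = z) ->
  cycle opt_rel ((w :: p1) ++ rev (t :: p2)).
Proof.
move=> f1 f2 U L; move: U; rewrite cat_uniq => /and3P [U1 /hasPn D U2].
have l1 : last w p1 \in w :: p1 := mem_last _ _.
have l2 : last t p2 \in t :: p2 := mem_last _ _.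
have o1 : path opt_rel w p1.
  apply: opt_rel_path => // y yin.
  have ny1 : y != last w p1.
    by apply: contraL yin => /eqP ->; move: U1; rewrite lastI rcons_uniq => /andP[].
  have ny2 : y != last t p2.
    by apply: contra (D _ l2) => /eqP <-; exact: mem_belast.
  by case: L => -[<- <-].
have o2 : path opt_rel t p2.
  apply: opt_rel_path => // y yin.
  have ny1 : y != last t p2.
    by apply: contraL yin => /eqP ->; move: U2; rewrite lastI rcons_uniq => /andP[].
  have ny2 : y != last w p1.
    by apply: contraL l1 => /eqP <-; apply: D; exact: mem_belast.
  by case: L => -[<- <-].
rewrite /= rcons_cat cat_path o1 /= lastI rev_rcons /= rcons_path.
have lt_t : last w (rev (t :: p2)) = t by rewrite rev_cons last_rcons.
rewrite lastI rev_rcons /= in lt_t; rewrite lt_t.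
rewrite [opt_rel t w]opt_rel_sym opt_rel_wt andbT.
apply/andP; split; last first.
  rewrite rev_path; move: o2; congr is_true; apply: eq_path => a b.
  exact: opt_rel_sym.
by case: L => -[-> ->]; rewrite ?opt_rel_uz // opt_rel_sym opt_rel_uz.
Qed.

(* Reversing one of the two arcs left by the removal of uw and zt: a cycle
   through both edges stays a single cycle, two cycles are merged. *)
Lemma opt_rel_hamiltonian :
  2 < #|T| ->
  order f u = #|T| \/ ~~ fconnect f u z /\ #|T| <= order f u + order f z ->
  exists c, [/\ size c = #|T|, uniq c, forall x, x \in c
                & forall x y, opt_rel x y = cyc_adj c x y].
Proof.
move=> T3 H.
suff [p1 [p2 [f1 f2 U sz L]]] : exists p1 p2, [/\ fpath f w p1, fpath f t p2,
    uniq ((w :: p1) ++ (t :: p2)), #|T| <= size ((w :: p1) ++ (t :: p2)) &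
    (last w p1 = z /\ last t p2 = u) \/ (last w p1 = u /\ last t p2 = z)].
  have oc := opt_rel_cycle f1 f2 U L.
  set c := (w :: p1) ++ rev (t :: p2) in oc.
  have pc : perm_eq c ((w :: p1) ++ (t :: p2)) by rewrite perm_cat2l perm_rev.
  have Uc : uniq c by rewrite (perm_uniq pc).
  have sc : size c = #|T|.
    apply/eqP; rewrite eqn_leq (perm_size pc) sz andbT -(perm_size pc).
    by rewrite -(card_uniqP Uc) max_card.
  have inc x : x \in c.
    by apply: uniq_full; rewrite ?sc.
  exists c; split => //.
  apply: (cyc_adj_of_degree2 opt_rel_sym) => //; last by rewrite sc.
  by move=> x y; exact.
have ordS a : order f (f a) = order f a.
  by apply: eq_card => x; rewrite !inE -same_fconnect1.
have last_orbit a : iter (order f (f a)).-1 f (f a) = a by exact: finv_f.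
have [r Er] : exists r, order f w = r.+1.
  by exists (order f w).-1; rewrite prednK ?order_gt0.
case: H => [ou | [nc le_T]].
- have oT : order f w = #|T| by rewrite ordS.
  have zw : fconnect f w z.
    by rewrite fconnect_orbit; apply: uniq_full; rewrite ?orbit_uniq ?size_orbit ?oT.
  have ltz := findex_max zw; have Ez := iter_findex zw.
  set i := findex f w z in ltz Ez; rewrite Er ltnS leq_eqVlt in ltz.
  (* The orbit of w ends in u, which is not z, so an arc starting at t is left after z. *)
  have ltir : i < r.
    case/orP: ltz => // /eqP ir; case/eqP: nuz.
    by rewrite -Ez ir -[u]last_orbit Er.
  have Et : t = iter i.+1 f w by rewrite /= Ez.
  exists (traject f (f w) i), (traject f (f t) (r - i.+1)).
  have E : (w :: traject f (f w) i) ++ (t :: traject f (f t) (r - i.+1)) = orbit f w.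
    rewrite -!trajectS /orbit Er -[in RHS](_ : i.+1 + (r - i.+1).+1 = r.+1); last by lia.
    by rewrite trajectD Et.
  split; rewrite ?fpath_traject // ?E ?orbit_uniq ?size_orbit ?oT //.
  left; rewrite !last_traject Ez; split=> //; rewrite Et -iterD.
  by rewrite -[u]last_orbit Er /=; congr iter; lia.
- have [q Eq] : exists q, order f t = q.+1.
    by exists (order f t).-1; rewrite prednK ?order_gt0.
  exists (traject f (f w) r), (traject f (f t) q).
  have E1 : w :: traject f (f w) r = orbit f w by rewrite -trajectS /orbit Er.
  have E2 : t :: traject f (f t) q = orbit f t by rewrite -trajectS /orbit Eq.
  split; rewrite ?fpath_traject // ?E1 ?E2 ?size_cat ?size_orbit ?ordS //.
    rewrite cat_uniq !orbit_uniq andbT /=; apply/hasPn => x.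
    rewrite -!fconnect_orbit -!same_fconnect1 // => zx; apply: contra nc => ux.
    by apply: connect_trans ux _; rewrite fconnect_sym.
  right; rewrite !last_traject; split; first by rewrite -[u]last_orbit Er.
  by rewrite -[z]last_orbit Eq.
Qed.

End TwoOpt.

Definition quad_edge (T : eqType) (u t w z : T) : rel T := fun x y =>
  (x \in [:: u; t]) && (y \in [:: w; z]) || (x \in [:: w; z]) && (y \in [:: u; t]).

Lemma quad_edge_swap (T : eqType) (u t w z x y : T) :
  quad_edge u t w z x y = quad_edge t u w z x y.
Proof. by rewrite /quad_edge !inE ![(_ == u) || _]orbC. Qed.

(* Exchanging the edges of the alternating 4-cycle u w t z between the step
   relations of f and g is a 2-opt move on f. *)
Lemma step_rel_switch (T : finType) (f g : T -> T) (u t w z : T) :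
  injective f -> injective g -> uniq [:: u; t; w; z] ->
  f u = w -> f z = t -> g t = w -> g z = u -> f w != u -> f t != z ->
  forall x y, (if quad_edge u t w z x y then step_rel g x y else step_rel f x y)
              = opt_rel f u z x y.
Proof.
move=> fI gI; rewrite /= !inE !negb_or -!andbA andbT.
case/and5P=> ut uw uz tw /andP[tz wz] fu fz gt gz fw ft x y.
have fE a b : (a == finv f b) = (b == f a).
  by rewrite -(inj_eq fI) f_finv // eq_sym.
have guw : (w == g u) = false by rewrite -gt (inj_eq gI) eq_sym (negPf ut).
have gwu : (u == g w) = false by rewrite -gz (inj_eq gI) eq_sym (negPf wz).
have fyw b : (w == f b) = (b == u) by rewrite -fu (inj_eq fI) eq_sym.
have fyt b : (t == f b) = (b == z) by rewrite -fz (inj_eq fI) eq_sym.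
rewrite /opt_rel /opt_out /opt_in /step_rel /quad_edge !inE fu fz.
have [->|xu] := eqVneq x u.
  rewrite (negPf ut) (negPf uw) (negPf uz) /= fE fu.
  have [->|yw] := eqVneq y w; first by rewrite guw gwu (negPf wz) eq_sym (negPf fw).
  have [->|yz] /= := eqVneq y z; first by rewrite gz eqxx orbT.
  by [].
have [->|xz] := eqVneq x z.
  rewrite [z == t]eq_sym [z == w]eq_sym (negPf tz) (negPf wz) /= fE fz.
  have [->|yu] := eqVneq y u; first by rewrite gz eqxx.
  have [->|yt] /= := eqVneq y t.
    by rewrite gz gt [t == u]eq_sym (negPf ut) [z == w]eq_sym (negPf wz)
               [z == f t]eq_sym (negPf ft).
  by [].
have [->|xw] := eqVneq x w.
  rewrite [w == t]eq_sym (negPf tw) /=.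
  have [->|yu] := eqVneq y u.
    by rewrite gwu guw (negPf ut) eq_sym (negPf fw).
  have [->|yt] /= := eqVneq y t; first by rewrite gt eqxx !orbT.
  by rewrite fyw (negPf yu).
have [->|xt] /= := eqVneq x t.
  rewrite fyt orbF.
  have [->|yw] := eqVneq y w; first by rewrite gt eqxx orbT.
  have [->|yz] /= := eqVneq y z.
    by rewrite gt gz [z == w]eq_sym (negPf wz) [t == u]eq_sym (negPf ut) eq_sym (negPf ft).
  by [].
by rewrite fE.
Qed.

(** Serves to index the factors by any finite type with the two kinds mixed; [g] enumerates that
    type with the C_M-factors in front, as [HWP] wants them. *)
Lemma HWP_of_family (T K : finType) (G : rel T) (M N a b : nat)
    (F : K -> rel T) (kind : pred K) :
  #|[pred k | ~~ kind k]| = a -> #|kind| = b ->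
  (forall k, is_Ck_factor G (if kind k then N else M) (F k)) ->
  (forall x y, #|[set k | F k x y]| = G x y) -> HWP G M N a b.
Proof.
move=> ca cb Ff Fp.
pose e := enum [pred k | ~~ kind k] ++ enum kind.
have se : size e == a + b by rewrite size_cat -!cardE ca cb.
have Ue : uniq e.
  rewrite cat_uniq !enum_uniq andbT /=; apply/hasPn => k.
  by rewrite !mem_enum !inE negbK.
pose g := tnth (Tuple se).
have g_inj : injective g by move=> i j; exact: (tuple_uniqP (Tuple se) Ue).
have cK : #|K| = #|'I_(a + b)|.
  by rewrite card_ord -ca -cb addnC -(cardC kind); congr (_ + _); apply: eq_card.
have g_bij : bijective g by apply: (inj_card_bij g_inj); rewrite cK.
exists (fun i => F (g i)); split=> [i | x y].
  have -> : (i < a) = ~~ kind (g i).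
    rewrite /g (tnth_nth (g i)) /= nth_cat -cardE ca.
    have := mem_nth (g i) (_ : i < size (enum [pred k | ~~ kind k])).
    have := mem_nth (g i) (_ : i - a < size (enum kind)).
    rewrite -!cardE ca cb !mem_enum !inE; have [ia _ /(_ isT) -> // | ia] := ltnP i a.
    have ib : i - a < b by have := ltn_ord i; lia.
    by move=> /(_ ib); rewrite unfold_in => ->.
  by have := Ff (g i); case: (kind (g i)).
rewrite -(Fp x y) -(@on_card_preimset _ _ g [set k | F k x y]).
  by apply: eq_card => i; rewrite !inE.
exact: onW_bij.
Qed.

(** * Factorizations from layered families of permutations *)

Section Layered.
Variables (M n : nat) (s : 'I_n -> 'I_M -> 'I_n -> 'I_n).
Hypothesis M_ge3 : 2 < M.
Hypothesis s_inj : forall k i, injective (s k i).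
Hypothesis s_latin : forall i x, injective (fun k => s k i x).

Definition layer_step (k : 'I_n) (v : 'I_M * 'I_n) := (ordS v.1, s k v.1 v.2).

Lemma ordS_injective : injective (@ordS M).
Proof. exact: can_inj (@ordSK M). Qed.

(** As M > 2, two steps around the M-cycle never return to the start. Hence an edge between layers
    can be read in one direction only. *)
Lemma ordS_asym (i j : 'I_M) : ordS i = j -> ordS j != i.
Proof.
move=> <-; apply/eqP => /(congr1 val) /= e; have lti := ltn_ord i; move: e.
have [iM|Mi] := ltnP i.+1 M; last first.
  have -> : i.+1 = M by lia.
  by rewrite modnn modn_small; lia.
rewrite (modn_small iM); have [iM'|Mi] := ltnP i.+2 M; first by rewrite modn_small; lia.
have -> : i.+2 = M by lia.
by rewrite modnn; lia.
Qed.

Lemma layer_step_inj k : injective (layer_step k).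
Proof.
move=> [i x] [j y] [e]; have {e} -> : i = j by apply: ordS_injective; apply: val_inj.
by move=> /s_inj ->.
Qed.

Lemma lexC_sym : symmetric (lexC M n).
Proof. by move=> x y; rewrite /lexC orbC. Qed.

Lemma layer_step_lexC k v : lexC M n v (layer_step k v).
Proof. by rewrite /lexC /= eqxx. Qed.

Lemma layer_step_eq k x y :
  (y == layer_step k x) = (y.1 == ordS x.1) && (y.2 == s k x.1 x.2).
Proof. by case: y => j y /=; rewrite xpair_eqE. Qed.

(** An edge leads from a layer to the next in exactly one direction, and by sharp transitivity
    exactly one row maps its first end to the second. *)
Lemma layered_partition (x y : 'I_M * 'I_n) :
  #|[set k | step_rel (layer_step k) x y]| = lexC M n x y.
Proof.
have card1 i a b : #|[set k | b == s k i a]| = 1.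
  have sb : bijective (fun k => s k i a) by apply: injF_bij.
  rewrite -(cards1 b) -(@on_card_preimset _ _ (fun k => s k i a) [set b]); last exact: onW_bij.
  by apply: eq_card => k; rewrite !inE eq_sym.
have lexE : lexC M n x y = (y.1 == ordS x.1) || (x.1 == ordS y.1).
  by rewrite /lexC [y.1 == _]eq_sym [x.1 == _]eq_sym.
have E k : step_rel (layer_step k) x y =
   (y.1 == ordS x.1) && (y.2 == s k x.1 x.2) || (x.1 == ordS y.1) && (x.2 == s k y.1 y.2).
  by rewrite /step_rel !layer_step_eq.
under eq_finset do rewrite E.
rewrite lexE; have [yx|nyx] := eqVneq y.1 (ordS x.1).
  rewrite /= -(card1 x.1 x.2 y.2); apply: eq_card => k; rewrite !inE /=.
  by have /negPf := ordS_asym (esym yx); rewrite eq_sym => ->; rewrite orbF.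
have [xy|nxy] /= := eqVneq x.1 (ordS y.1); first exact: card1.
by rewrite -(cards0 'I_n); apply: eq_card => k; rewrite !inE.
Qed.

Lemma layered_HWP (kind : pred 'I_n) y :
  y <= n -> #|kind| = y ->
  (forall k v, order (layer_step k) v = if kind k then M * n else M) ->
  HWP (lexC M n) M (M * n) (n - y) y.
Proof.
move=> yn cy Hord.
apply: (@HWP_of_family _ _ _ _ _ _ _ (fun k => step_rel (layer_step k)) kind) => //.
- have := cardC kind; rewrite card_ord cy => e.
  have -> : #|[pred k | ~~ kind k]| = #|predC kind| by apply: eq_card.
  by apply/eqP; rewrite -(eqn_add2l y) e subnKC.
- move=> k; apply: step_rel_factor; first exact: layer_step_inj.
  + exact: layer_step_lexC.
  + exact: lexC_sym.
  + exact: Hord.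
- exact: layered_partition.
Qed.

Lemma iter_layer_step1 k v e : (iter e (layer_step k) v).1 = (v.1 + e) %% M :> nat.
Proof.
elim: e => [|e IH] /=; first by rewrite addn0 modn_small.
by rewrite IH -addn1 modnDml addn1 addnS.
Qed.

Lemma order_layer_step_dvd k v : M %| order (layer_step k) v.
Proof.
have := iter_layer_step1 k v (order (layer_step k) v).
rewrite iter_order; last exact: layer_step_inj.
rewrite -{1}(modn_small (ltn_ord v.1)) -{1}[v.1 : nat]addn0 => /eqP.
by rewrite eqn_modDl mod0n eq_sym.
Qed.

(** Rows p and q alternate along the 4-cycle u w t z. Exchanging the two labels on its edges is a
    2-opt move on both factors: it merges the two cycles of row p, through u and through z, and
    keeps the Hamiltonian cycle of row q in one piece. *)
Lemma switched_HWP (kind : pred 'I_n) y (p q : 'I_n) (u t w z : 'I_M * 'I_n) :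
  y <= n -> #|kind| = y -> 0 < n -> p != q -> kind p -> kind q ->
  u != t -> layer_step p u = w -> layer_step p z = t ->
  layer_step q t = w -> layer_step q z = u ->
  order (layer_step q) t = M * n ->
  ~~ fconnect (layer_step p) u z ->
  M * n <= order (layer_step p) u + order (layer_step p) z ->
  (forall k v, k != p -> k != q ->
     order (layer_step k) v = if kind k then M * n else M) ->
  HWP (lexC M n) M (M * n) (n - y) y.
Proof.
move=> yn cy n0 npq kp kq nut pu pz qt qz oq ncp op Hord.
have cT : #|{: 'I_M * 'I_n}| = M * n by rewrite card_prod !card_ord.
have [p_inj q_inj] := (@layer_step_inj p, @layer_step_inj q).
have no1 k k' a : layer_step k (layer_step k' a) != a.
  by apply/eqP => /(congr1 fst) /= e; have := ordS_asym (erefl (ordS a.1)); rewrite e eqxx.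
have no0 k a : layer_step k a != a.
  apply/eqP => /(congr1 fst) /= e; have := ordS_asym e.
  by rewrite e eqxx.
have tz : t != z by rewrite -pz no0.
have uz : u != z by rewrite -qz no0.
have wz : w != z by rewrite -pu -qz no1.
have U : uniq [:: u; t; w; z].
  rewrite /= !inE !negb_or nut tz uz wz.
  by rewrite -{1}pu [u == _]eq_sym no0 -qt [t == _]eq_sym no0.
have U' : uniq [:: t; u; w; z].
  by rewrite -(perm_uniq (_ : perm_eq [:: u; t; w; z] _)) //; apply/permPl; exact: (perm_catCA [:: u] [:: t]).
pose sw k := if k == p then q else if k == q then p else k.
have swL : sw p = q by rewrite /sw eqxx.
have swR : sw q = p by rewrite /sw eqxx eq_sym (negPf npq).
have swK : involutive sw.
  move=> k; rewrite {2}/sw; have [->|kp'] := eqVneq k p; first by rewrite swR.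
  have [->|kq'] := eqVneq k q; first by rewrite swL.
  by rewrite /sw (negPf kp') (negPf kq').
pose F k x y := step_rel (layer_step (if quad_edge u t w z x y then sw k else k)) x y.
have Fp x b : F p x b = opt_rel (layer_step p) u z x b.
  rewrite /F -(@step_rel_switch _ _ (layer_step q) u t w z) // ?swL.
  - by case: (quad_edge _ _ _ _ _ _).
  - by rewrite -pu no1.
  - by rewrite -pz no1.
(* Seen from row q the same 4-cycle has u and t in exchanged roles. *)
have Fq x b : F q x b = opt_rel (layer_step q) t z x b.
  rewrite /F quad_edge_swap -(@step_rel_switch _ _ (layer_step p) t u w z) // ?swR.
  - by case: (quad_edge _ _ _ _ _ _).
  - by rewrite -qt no1.
  - by rewrite -qz no1.
have FG k x y1 : F k x y1 -> lexC M n x y1.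
  rewrite /F; case/orP=> /eqP ->; first exact: layer_step_lexC.
  by rewrite lexC_sym layer_step_lexC.
have ham r a : kind r -> F r =2 opt_rel (layer_step r) a z -> a != z ->
    order (layer_step r) a = M * n \/
    ~~ fconnect (layer_step r) a z /\ M * n <= order (layer_step r) a + order (layer_step r) z ->
    is_Ck_factor (lexC M n) (M * n) (F r).
  move=> kr Fr az H; rewrite -!cT in H *.
  have [|c [sc Uc inc Hc]] := @opt_rel_hamiltonian _ _ (@layer_step_inj r) a z az _ H.
    by rewrite cT; apply: leq_trans M_ge3 _; rewrite leq_pmulr.
  split=> [x y' | x y' | v]; first by rewrite !Fr opt_rel_sym //; exact: layer_step_inj.
    exact: FG.
  by exists c; split=> // x y' _; rewrite Fr Hc.
apply: (@HWP_of_family _ _ _ _ _ _ _ F kind) => //.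
- have := cardC kind; rewrite card_ord cy => e.
  have -> : #|[pred k | ~~ kind k]| = #|predC kind| by apply: eq_card.
  by apply/eqP; rewrite -(eqn_add2l y) e subnKC.
- move=> k; have [->|kp'] := eqVneq k p; first by rewrite kp; apply: (ham p u) => //; right.
  have [->|kq'] := eqVneq k q; first by rewrite kq; apply: (ham q t) => //; left.
  have Fk x y' : F k x y' = step_rel (layer_step k) x y'.
    by rewrite /F /sw (negPf kp') (negPf kq') if_same.
  have [S1 S2 S3] := step_rel_factor (@layer_step_inj k) (layer_step_lexC k) lexC_sym
    (fun v => Hord k v kp' kq').
  split=> [x y' | x y' | v]; [by rewrite !Fk S1 | by rewrite Fk; exact: S2 |].
  by have [c [c1 c2 c3 c4]] := S3 v; exists c; split=> // x y' xc; rewrite Fk c4.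
- move=> x y1; rewrite -layered_partition /F.
  (* On an edge of the 4-cycle the rows are merely renamed by the involution [sw], which does not
     change the count. *)
  case: (quad_edge _ _ _ _ _ _) => //.
  rewrite -[RHS](@on_card_preimset _ _ sw); last exact: onW_bij (inv_bij swK).
  by apply: eq_card => k; rewrite !inE.
Qed.

End Layered.

(** * Row-sum matrices over the integers modulo n *)

Section RowSum.
Variables (n M : nat) (c : nat -> nat -> nat).
Hypothesis n_gt0 : 0 < n.
Hypothesis M_ge3 : 2 < M.
Hypothesis c_inj : forall i k k', i < M -> k < n -> k' < n ->
  c i k = c i k' %[mod n] -> k = k'.

Definition shift (d : nat) (x : 'I_n) : 'I_n := Ordinal (ltn_pmod (x + d) n_gt0).
Definition row_sum (k : nat) := \sum_(i < M) c i k.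

Lemma shift_inj d : injective (shift d).
Proof.
move=> x y /(congr1 val) /= /eqP; rewrite eqn_modDr !modn_small // => /eqP.
exact: val_inj.
Qed.

Let s (k : 'I_n) (i : 'I_M) := shift (c i k).
Let f := layer_step s.

Lemma rowsum_inj k i : injective (s k i). Proof. exact: shift_inj. Qed.

Lemma rowsum_latin i x : injective (fun k => s k i x).
Proof.
move=> k k' /(congr1 val) /= /eqP; rewrite eqn_modDl => /eqP e.
by apply: val_inj; exact: c_inj (ltn_ord i) (ltn_ord k) (ltn_ord k') e.
Qed.

Let f_inj k : injective (f k). Proof. exact: layer_step_inj rowsum_inj _. Qed.

Lemma iter_layer0 k (v : 'I_M * 'I_n) e : v.1 = 0 :> nat -> e <= M ->
  (iter e (f k) v).2 = (v.2 + \sum_(i < e) c i k) %% n :> nat.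
Proof.
move=> v0; elim: e => [|e IH] eM; first by rewrite big_ord0 addn0 modn_small.
rewrite iterS /= IH ?(ltnW eM) // big_ord_recr /= (iter_layer_step1 s k v e) v0 add0n.
by rewrite (modn_small eM) modnDml addnA.
Qed.

Lemma iter_layerM k v : iter M (f k) v = (v.1, shift (row_sum k) v.2).
Proof.
have M0 : 0 < M by apply: leq_trans M_ge3.
pose C := \sum_(i < v.1) c i k.
(* [v0] is the vertex of layer 0 from which row k reaches v in v.1 steps; a full turn from v is
   compared with the one from [v0]. *)
pose v0 : 'I_M * 'I_n := (Ordinal M0, shift (n - C %% n) v.2).
have ltv := ltn_ord v.1.
have Ev : iter v.1 (f k) v0 = v.
  rewrite [RHS]surjective_pairing [LHS]surjective_pairing; congr pair; apply: val_inj.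
    by rewrite /= iter_layer_step1 modn_small.
  rewrite /= iter_layer0 ?(ltnW ltv) //= modnDml -/C -addnA.
  have -> : n - C %% n + C = n + C %/ n * n.
    by have := divn_eq C n; have := ltn_pmod C n_gt0; lia.
  by rewrite addnA [_ + _ * n]addnC modnMDl modnDr modn_small.
rewrite -{1}Ev -iterD addnC iterD.
have -> : iter M (f k) v0 = (Ordinal M0, shift (row_sum k) v0.2).
  rewrite [LHS]surjective_pairing; congr pair; apply: val_inj.
    by rewrite /= iter_layer_step1 add0n modnn.
  by rewrite /= iter_layer0.
rewrite [LHS]surjective_pairing; congr pair; apply: val_inj.
  by rewrite /= iter_layer_step1 modn_small.
rewrite /= iter_layer0 ?(ltnW ltv) //= -/C -[in RHS]Ev iter_layer0 ?(ltnW ltv) //= -/C.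
by rewrite !modnDml addnAC.
Qed.

Lemma iter_layerMM k v j : iter (M * j) (f k) v = (v.1, shift (j * row_sum k) v.2).
Proof.
elim: j => [|j IH].
  rewrite muln0 mul0n [LHS]surjective_pairing; congr pair; apply: val_inj.
  by rewrite /= addn0 modn_small.
rewrite mulnS iterD IH iter_layerM /=; congr pair; apply: val_inj.
by rewrite /= modnDml -addnA mulSn [row_sum k + _]addnC.
Qed.

Lemma iter_layerMM_fix k v j : iter (M * j) (f k) v = v -> n %| j * row_sum k.
Proof.
rewrite iter_layerMM => /(congr1 snd) /(congr1 val) /= e; apply/eqP.
have /eqP : v.2 + j * row_sum k = v.2 + 0 %[mod n] by rewrite e addn0 modn_small.
by rewrite eqn_modDl mod0n => /eqP.
Qed.

Lemma order_zero_row (k : 'I_n) v : n %| row_sum k -> order (f k) v = M.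
Proof.
move=> dv; have M0 : 0 < M by apply: leq_trans M_ge3.
apply/eqP; rewrite eqn_leq order_le_iter //=; last first.
  rewrite iter_layerM [RHS]surjective_pairing; congr pair; apply: val_inj.
  by rewrite /= -modnDmr (eqP dv) addn0 modn_small.
by apply: dvdn_leq; rewrite ?order_gt0 // (order_layer_step_dvd rowsum_inj).
Qed.

(** A return takes M j steps with n dividing j times the row sum, which forces n / g to divide j. *)
Lemma order_row_ge (k : 'I_n) v g : gcdn n (row_sum k) = g -> M * (n %/ g) <= order (f k) v.
Proof.
move=> Eg.
have /dvdnP [j Ej] : M %| order (f k) v := order_layer_step_dvd rowsum_inj k v.
have o0 : 0 < order (f k) v := order_gt0 _ _.
have := iter_order (@f_inj k) v; rewrite Ej mulnC => /iter_layerMM_fix dv.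
move: o0; rewrite Ej muln_gt0 => /andP [j0 _].
rewrite leq_mul2l -Eg; apply/orP; right; apply: dvdn_leq => //.
have g0 : 0 < gcdn n (row_sum k) by rewrite gcdn_gt0 n_gt0.
rewrite -(dvdn_pmul2r g0) divnK ?dvdn_gcdl //.
by rewrite muln_gcdr dvdn_gcd dvdn_mull //=.
Qed.

Lemma order_unit_row (k : 'I_n) v : coprime n (row_sum k) -> order (f k) v = M * n.
Proof.
move=> /eqP g1; apply/eqP; rewrite eqn_leq; apply/andP; split.
  by apply: leq_trans (max_card _) _; rewrite card_prod !card_ord.
by have := order_row_ge v g1; rewrite divn1.
Qed.

Lemma card_ord_in_seq (nz : seq nat) :
  uniq nz -> all (gtn n) nz -> #|[pred k : 'I_n | val k \in nz]| = size nz.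
Proof.
move=> U A.
have -> : size nz = size (pmap (insub : nat -> option 'I_n) nz).
  by rewrite size_pmap_sub; apply/esym/eqP; rewrite -all_count.
rewrite -(card_uniqP (pmap_sub_uniq _ U)); apply: eq_card => k.
by rewrite !inE mem_pmap_sub.
Qed.

Theorem rowsum_HWP (nz : seq nat) :
  uniq nz -> all (gtn n) nz ->
  (forall k, k < n -> if k \in nz then coprime n (row_sum k) else n %| row_sum k) ->
  HWP (lexC M n) M (M * n) (n - size nz) (size nz).
Proof.
move=> U A H.
have cy := card_ord_in_seq U A.
apply: (layered_HWP M_ge3 rowsum_inj rowsum_latin _ cy).
  by rewrite -cy -[n in _ <= n]card_ord max_card.
move=> k v; have := H k (ltn_ord k); rewrite inE /=; case: ifP => _.
  exact: order_unit_row.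
exact: order_zero_row.
Qed.

(** Let f_p and f_q be the steps of rows p and q, and z = (0, 0). The congruence between columns 0
    and 1 says f_p (f_q z) = f_q (f_p z), so these points close up to an alternating 4-cycle. The
    sum of row p is even, so within a layer its cycles preserve parity; as c_0(p) + c_0(q) is odd,
    f_p z and f_q z lie on different cycles, each covering at least half of the vertices. *)
Theorem rowsum_switched_HWP (nz : seq nat) (p q : nat) :
  uniq nz -> all (gtn n) nz -> p \in nz -> q \in nz -> p != q ->
  ~~ odd n -> gcdn n (row_sum p) = 2 -> odd (c 0 p + c 0 q) ->
  c 0 p + c 1 q = c 0 q + c 1 p %[mod n] ->
  (forall k, k < n -> k != p -> if k \in nz then coprime n (row_sum k) else n %| row_sum k) ->
  HWP (lexC M n) M (M * n) (n - size nz) (size nz).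
Proof.
move=> U A pin qin npq en gp oc Ec H.
have pn : p < n by apply: (allP A).
have qn : q < n by apply: (allP A).
have cy := card_ord_in_seq U A.
have M0 : 0 < M by apply: leq_trans M_ge3.
pose P := Ordinal pn; pose Q := Ordinal qn.
pose z : 'I_M * 'I_n := (Ordinal M0, Ordinal n_gt0).
have nPQ : P != Q by rewrite -val_eqE.
have M1 : 1 %% M = 1 by rewrite modn_small // ltnW.
have fz k : (f k z).2 = c 0 k %% n :> nat by [].
have fz1 k : (f k z).1 = 1 :> nat by rewrite /= M1.
have cop k : k < n -> k != p -> k \in nz -> coprime n (row_sum k).
  by move=> kn kp kin; have := H k kn kp; rewrite kin.
have gp2 : 2 %| row_sum p by rewrite -gp dvdn_gcdr.
have n2 : 2 %| n by rewrite dvdn2.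
apply: (@switched_HWP M n s M_ge3 rowsum_inj rowsum_latin
  [pred k : 'I_n | val k \in nz] _ P Q (f Q z) (f P z) (f P (f Q z)) z) => //.
- by rewrite -cy -[n in _ <= n]card_ord max_card.
- apply/eqP => /(congr1 snd) /(@rowsum_latin _ _) /eqP.
  by rewrite eq_sym (negPf nPQ).
- rewrite [LHS]surjective_pairing [RHS]surjective_pairing; congr pair; apply: val_inj => //=.
  by rewrite !M1 !add0n !modnDml Ec.
- by apply: order_unit_row; apply: cop; rewrite // eq_sym.
- apply/negP => uz.
  have : fconnect (f P) (f Q z) (f P z) by apply: connect_trans uz (fconnect1 _ _).
  move=> /iter_findex; set e := findex _ _ _ => Ee.
  have /dvdnP [j Ej] : M %| e.
    have := iter_layer_step1 s P (f Q z) e; rewrite -/f Ee !fz1 => /esym/eqP.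
    by rewrite -{2}M1 -{2}[1]addn0 eqn_modDl mod0n.
  move: Ee; rewrite Ej mulnC iter_layerMM => /(congr1 snd) /(congr1 val) /=.
  rewrite !add0n modnDml => /eqP /(fun E => eqP E) E.
  have : c 0 q + j * row_sum p = c 0 p %[mod 2].
    by rewrite -(modn_dvdm _ n2) E modn_dvdm.
  rewrite -modnDmr -modnMmr (eqP gp2) muln0 mod0n addn0 !modn2.
  by move: oc; rewrite oddD; case: (odd _); case: (odd _).
- have gP := gp; have o1 := order_row_ge (k := P) (f Q z) gp.
  have o2 := order_row_ge (k := P) z gp.
  apply: leq_trans (leq_add o1 o2).
  by rewrite -mulnDr addnn -muln2 divnK.
- move=> k v kP _; have := H k (ltn_ord k) kP; rewrite inE /=; case: ifP => _.
    exact: order_unit_row.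
  exact: order_zero_row.
Qed.

End RowSum.

(** * Few columns suffice: padding by cancelling pairs *)

Definition col_inj (n : nat) (g : nat -> nat) :=
  forall k k', k < n -> k' < n -> g k = g k' %[mod n] -> k = k'.

(** Rows in [nz] are to become Hamiltonian cycles, all others C_M-factors. *)
Definition good_sum (n : nat) (nz : seq nat) (S : nat -> nat) (k : nat) : bool :=
  if k \in nz then coprime n (S k) else n %| S k.

Lemma col_inj_lt n g : (forall k, k < n -> g k < n) ->
  (forall k k', k < n -> k' < n -> g k = g k' -> k = k') -> col_inj n g.
Proof. by move=> lt I k k' kn kn'; rewrite !modn_small ?lt //; exact: I. Qed.

Lemma col_inj_opp n g : (forall k, k < n -> g k < n) ->
  (forall k k', k < n -> k' < n -> g k = g k' -> k = k') -> col_inj n (fun k => n - g k).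
Proof.
move=> lt I k k' kn kn' e; apply: I => //.
have [lt1 lt2] := (lt k kn, lt k' kn').
have : (g k + g k') + (n - g k) = (g k + g k') + (n - g k') %[mod n].
  by apply/eqP; rewrite eqn_modDl e.
have -> : (g k + g k') + (n - g k) = g k' + n by lia.
have -> : (g k + g k') + (n - g k') = g k + n by lia.
by rewrite !modnDr !modn_small.
Qed.

Lemma gcdn_opp n X L : n %| X + L -> gcdn n X = gcdn n L.
Proof.
have H a b : n %| a + b -> gcdn n a %| gcdn n b.
  move=> dv; rewrite dvdn_gcd dvdn_gcdl /=.
  by rewrite -(dvdn_addr _ (dvdn_gcdr n a)) (dvdn_trans (dvdn_gcdl _ _)).
by move=> dv; apply/eqP; rewrite eqn_dvd !H // addnC.
Qed.

Section Columns.
Variables (n M : nat) (base : seq (nat -> nat)).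
Hypothesis n_gt0 : 0 < n.
Hypothesis M_ge3 : 2 < M.
Hypothesis base_M : size base <= M.
Hypothesis base_even : ~~ odd (M - size base).
Hypothesis base_inj : forall i, i < size base -> col_inj n (nth id base i).

(** Behind [base] the columns k and -k alternate. They cancel modulo n, so the row sums depend on
    [base] alone as long as the number of added columns is even. *)
Definition pad_cols (i k : nat) : nat :=
  if i < size base then nth id base i k
  else if odd (i - size base) then n - k else k.

Definition base_sum k := \sum_(g <- base) g k.

Lemma pad_cols_inj i k k' : i < M -> k < n -> k' < n ->
  pad_cols i k = pad_cols i k' %[mod n] -> k = k'.
Proof.
move=> iM kn kn'; rewrite /pad_cols; case: ifP => ib; first exact: base_inj.
case: ifP => _; first by apply: (@col_inj_opp n id).
by rewrite !modn_small.
Qed.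

Lemma row_sum_pad k : k <= n ->
  row_sum M pad_cols k = base_sum k + (M - size base)./2 * n.
Proof.
move=> kn; rewrite /row_sum /base_sum.
have -> : \sum_(i < M) pad_cols i k = \sum_(i < size base + (M - size base)) pad_cols i k.
  by rewrite subnKC.
rewrite big_split_ord /=; congr (_ + _).
  rewrite (big_nth id) big_mkord; apply: eq_bigr => i _.
  by rewrite /pad_cols ltn_ord.
move: base_even; set m := M - _.
have E j : \sum_(i < j.*2) pad_cols (size base + i) k = j * n.
  elim: j => [|j IH]; first by rewrite double0 big_ord0.
  rewrite doubleS !big_ord_recr /= IH /pad_cols !ltnNge !leq_addr /= !addKn /=.
  by rewrite odd_double /= mulSn; lia.
by move/negPf => om; have := E m./2; rewrite -[m./2.*2]add0n -[0]/(nat_of_bool false) -om odd_double_half.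
Qed.

Lemma good_sum_pad nz k : k <= n ->
  good_sum n nz (row_sum M pad_cols) k = good_sum n nz base_sum k.
Proof.
move=> kn; rewrite /good_sum row_sum_pad //; case: ifP => _.
  by rewrite /coprime addnC gcdnMDl.
by rewrite dvdn_addl // dvdn_mull.
Qed.

Lemma base_HWP nz :
  uniq nz -> all (gtn n) nz -> (forall k, k < n -> good_sum n nz base_sum k) ->
  HWP (lexC M n) M (M * n) (n - size nz) (size nz).
Proof.
move=> U A H; apply: (rowsum_HWP n_gt0 M_ge3 pad_cols_inj) => // k kn.
by move: (H k kn); rewrite -good_sum_pad // ltnW.
Qed.

Lemma base_switched_HWP nz p q :
  1 < size base ->
  uniq nz -> all (gtn n) nz -> p \in nz -> q \in nz -> p != q ->
  ~~ odd n -> gcdn n (base_sum p) = 2 ->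
  odd (nth id base 0 p + nth id base 0 q) ->
  nth id base 0 p + nth id base 1 q = nth id base 0 q + nth id base 1 p %[mod n] ->
  (forall k, k < n -> k != p -> good_sum n nz base_sum k) ->
  HWP (lexC M n) M (M * n) (n - size nz) (size nz).
Proof.
move=> sb U A pin qin npq en gp oc Ec H.
have pn : p < n by apply: (allP A).
apply: (rowsum_switched_HWP n_gt0 M_ge3 pad_cols_inj U A pin qin npq en) => //.
- by rewrite row_sum_pad ?(ltnW pn) // addnC gcdnMDl.
- by rewrite /pad_cols (ltnW sb).
- by rewrite /pad_cols (ltnW sb) sb.
- by move=> k kn kp; move: (H k kn kp); rewrite -good_sum_pad // ltnW.
Qed.

End Columns.

(* Exchanging, in one column, two consecutive entries of rows with sum 0 turns
   the two row sums into 1 and -1. *)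
Lemma swap_pairs n (a r : nat -> nat) (nz : seq nat) (p t : nat) (e e' : nat -> nat) :
  col_inj n a -> uniq nz -> all (gtn n) nz ->
  (forall k, k < n -> k != p -> good_sum n nz (fun k => a k + r k) k) ->
  (forall i, i < t -> [/\ e i < n, e' i < n, e i != p & e' i != p]) ->
  (forall i, i < t -> e i \notin nz /\ e' i \notin nz) ->
  (forall i, i < t -> a (e' i) = (a (e i)).+1 %[mod n]) ->
  (forall i j, i < t -> j < t -> e i != e' j) ->
  (forall i j, i < j -> j < t -> e i != e j /\ e' i != e' j) ->
  forall j, j <= t -> exists a' nz',
    [/\ col_inj n a', uniq nz', all (gtn n) nz' & size nz' = size nz + 2 * j] /\
    [/\ {subset nz <= nz'}, {in nz, a' =1 a} &
        forall k, k < n -> k != p -> good_sum n nz' (fun k => a' k + r k) k].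
Proof.
move=> aI U A G en enz ea ee' ee.
(* The induction also carries that the pairs from j on are still outside [nz'] and have their
   original entries. *)
suff H j : j <= t -> exists a' nz',
    [/\ col_inj n a', uniq nz', all (gtn n) nz' & size nz' = size nz + 2 * j] /\
    [/\ {subset nz <= nz'}, {in nz, a' =1 a},
        forall i, j <= i -> i < t -> [/\ e i \notin nz', e' i \notin nz',
           a' (e i) = a (e i) & a' (e' i) = a (e' i)] &
        forall k, k < n -> k != p -> good_sum n nz' (fun k => a' k + r k) k].
  move=> j jt; have [a' [nz' [H1 [H2 H3 _ H4]]]] := H j jt.
  by exists a', nz'; split.
elim: j => [|j IH] jt.
  exists a, nz; split; split => //; first by rewrite muln0 addn0.
  by move=> i _ it; have [? ?] := enz i it.
have [a' [nz' [[a'I U' A' s'] [sub eqa fresh G']]]] := IH (ltnW jt).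
have [fe fe' ae ae'] := fresh j (leqnn _) jt.
have [en1 en2 ep ep'] := en j jt; have [nz1 nz2] := enz j jt.
have nee : e j != e' j by apply: ee'.
pose tau k := if k == e j then e' j else if k == e' j then e j else k.
have tauK : involutive tau.
  move=> k; rewrite {2}/tau; have [->|k1] := eqVneq k (e j).
    by rewrite /tau eq_sym (negPf nee) eqxx.
  have [->|k2] := eqVneq k (e' j); first by rewrite /tau eqxx.
  by rewrite /tau (negPf k1) (negPf k2).
have taun k : k < n -> tau k < n by rewrite /tau; do 2?case: ifP.
exists (fun k => a' (tau k)), [:: e j, e' j & nz']; split; split.
- by move=> k k' kn kn' /(a'I _ _ (taun _ kn) (taun _ kn')) /(can_inj tauK).
- by rewrite /= inE negb_or nee fe fe' U'.
- by rewrite /= A' en1 en2.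
- by rewrite /= s'; lia.
- by move=> k kin; rewrite !inE sub ?orbT.
- move=> k kin; rewrite -eqa // /tau.
  have [ke|_] := eqVneq k (e j); first by rewrite ke (negPf nz1) in kin.
  by have [ke|_] := eqVneq k (e' j); first by rewrite ke (negPf nz2) in kin.
- move=> i ji it; have [i1 i2 i3 i4] := fresh i (ltnW ji) it.
  have [ne ne'] := ee j i ji it.
  have ne1 := ee' _ _ jt it; have ne2 := ee' _ _ it jt.
  rewrite !inE !negb_or i1 i2 /tau ![e i == _]eq_sym ![e' i == _]eq_sym.
  by rewrite (negPf ne) (negPf ne') (negPf ne1) [e' j == _]eq_sym (negPf ne2).
- move=> k kn kp; rewrite /good_sum !inE /tau.
  have z1 : n %| a (e j) + r (e j) by have := G' _ en1 ep; rewrite /good_sum (negPf fe) ae.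
  have z2 : n %| a (e' j) + r (e' j) by have := G' _ en2 ep'; rewrite /good_sum (negPf fe') ae'.
  have [->|k1] := eqVneq k (e j).
    rewrite /= ae' /coprime -gcdn_modr -modnDml (ea j jt) modnDml addSn -addn1.
    by rewrite -modnDml (eqP z1) add0n gcdn_modr gcdn1.
  have [->|k2] := eqVneq k (e' j).
    rewrite /= ae /coprime (@gcdn_opp n _ 1) ?gcdn1 //.
    by rewrite addnAC addn1 /dvdn -modnDml -(ea j jt) modnDml.
  exact: G'.
Qed.

Lemma base_sum0 k : base_sum [::] k = 0.
Proof. by rewrite /base_sum big_nil. Qed.

Lemma base_sum_cons g gs k : base_sum (g :: gs) k = g k + base_sum gs k.
Proof. by rewrite /base_sum big_cons. Qed.

Lemma col_inj_id n : col_inj n id.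
Proof. exact: col_inj_lt. Qed.

Lemma col_inj_oppid n : col_inj n (subn n).
Proof. exact: col_inj_opp. Qed.

Lemma good_sum_eq n nz S S' k : S k = S' k -> good_sum n nz S k = good_sum n nz S' k.
Proof. by rewrite /good_sum => ->. Qed.

Lemma col_inj_mul n m g : coprime n m -> col_inj n g -> col_inj n (fun k => m * g k).
Proof.
move=> cnm gI k k' kn kn' e; apply: gI => //; apply/eqP.
wlog le_g : k k' kn kn' e / g k' <= g k => [H|].
  by case: (leqP (g k') (g k)) => [|/ltnW] /H; [exact | rewrite eq_sym; apply].
rewrite eqn_mod_dvd // -(Gauss_dvdr _ cnm) mulnBr -eqn_mod_dvd ?e //.
by rewrite leq_mul2l le_g orbT.
Qed.

(** * Balanced matrices: M even or n odd *)

Lemma rest_columns n M : 0 < n -> 2 < M -> ~~ odd M || odd n ->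
  exists rest : seq (nat -> nat),
    [/\ size rest < M, ~~ odd (M - (size rest).+1),
        forall i, i < size rest -> col_inj n (nth id rest i) &
        forall k, k < n -> n %| base_sum rest k + k].
Proof.
move=> n0 M3; have [oM /= on|eM _] := boolP (odd M).
  (* For M odd the sum -k is split as k - 2 k, where -2 k is a permutation because n is odd; for M
     even the single column -k does. *)
  exists [:: id; fun k => 2 * (n - k)]; split => //=.
  - lia.
  - case=> [|[|i]] //= _; first exact: col_inj_id.
    by apply: col_inj_mul; [rewrite coprimen2 | exact: col_inj_oppid].
  - move=> k kn; rewrite !base_sum_cons base_sum0.
    by rewrite (_ : _ + k = 2 * n) ?dvdn_mull //; lia.
exists [:: subn n]; split => //=; first by lia.
- lia.
- by case=> //= _; exact: col_inj_oppid.
- by move=> k kn; rewrite base_sum_cons base_sum0 addn0 subnK // ltnW.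
Qed.

Lemma coprime_opp n X L : n %| X + L -> coprime n L -> coprime n X.
Proof. by rewrite /coprime => /gcdn_opp ->. Qed.

Lemma coprime_add n X L : coprime n L -> L = X %[mod n] -> coprime n X.
Proof. by rewrite /coprime -gcdn_modr => + e; rewrite e gcdn_modr. Qed.

(** All rows start with sum 0; each exchange of rows 2 i and 2 i + 1 in the first column creates two
    unit sums. *)
Lemma HWP_balanced_even n M y : 1 < n -> 2 < M -> ~~ odd M || odd n -> ~~ odd y -> y <= n ->
  HWP (lexC M n) M (M * n) (n - y) y.
Proof.
move=> n1 M3 Mn oy yn; have n0 := ltnW n1.
have [rest [sr er rI rs]] := rest_columns n0 M3 Mn.
(* The exempt row is set to n, which is not a row, so all rows are controlled. *)
have [||||||||||a [nz [[aI U A sz] [_ _ G]]]] :=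
  @swap_pairs n id (base_sum rest) [::] n n./2 (fun i => 2 * i) (fun i => (2 * i).+1)
    _ _ _ _ _ _ _ _ _ y./2 _ => //; try by move=> *; lia.
- exact: col_inj_id.
- by move=> k kn _; rewrite /good_sum /= addnC rs.
- by move=> *; split; lia.
have -> : y = size nz by rewrite sz /=; lia.
apply: (@base_HWP n M (a :: rest)) => //=.
- by case.
- move=> k kn; rewrite (@good_sum_eq n nz _ (fun k => a k + base_sum rest k)) ?base_sum_cons //.
  by apply: G => //; rewrite neq_ltn kn.
Qed.

(** Rotating the entries of rows 0, 1, 2 gives them the sums 1, 1, -2; exchanges in the other rows
    add the rest. For n odd -2 is a unit, for n even row 2 has to be switched. *)
Lemma HWP_balanced_odd n M y : 2 < n -> 2 < M -> ~~ odd M || odd n -> odd y -> 2 < y -> y <= n ->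
  HWP (lexC M n) M (M * n) (n - y) y.
Proof.
move=> n2 M3 Mn oy y3 yn; have n0 : 0 < n by lia.
pose a0 k := if k == 0 then 1 else if k == 1 then 2 else if k == 2 then 0 else k.
have a0I : col_inj n a0.
  by apply: col_inj_lt => [k kn|k k' kn kn']; rewrite /a0; do ?case: eqVneq => ?; lia.
(* The exempt row p is row 2, with sum -2, or n, that is none; the latter requires -2 to be a
   unit. *)
have swap r : (forall k, k < n -> n %| r k + k) -> forall p, p = n \/ p = 2 -> (p = n -> odd n) ->
  exists a nz, [/\ col_inj n a, uniq nz, all (gtn n) nz & size nz = y] /\
    [/\ {subset [:: 0; 1; 2] <= nz}, {in [:: 0; 1; 2], a =1 a0} &
        forall k, k < n -> k != p -> good_sum n nz (fun k => a k + r k) k].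
  move=> rs p pE po.
  have [||||||||||a [nz [[aI U A sz] H]]] :=
    @swap_pairs n a0 r [:: 0; 1; 2] p (n - 3)./2 (fun i => 2 * i + 3) (fun i => (2 * i + 4))
      _ _ _ _ _ _ _ _ _ (y - 3)./2 _ => //; try by move=> *; lia.
  - by rewrite /= !andbT; lia.
  - move=> k kn kp; rewrite /good_sum /a0 !inE; have dk := rs k kn.
    have c1 m : m = k.+1 -> coprime n (m + r k).
      move=> ->; apply: (@coprime_add _ _ 1); first exact: coprimen1.
      have -> : k.+1 + r k = r k + k + 1 by lia.
      by rewrite -[in RHS]modnDml (eqP dk) add0n.
    have [k0|k0] /= := eqVneq k 0; first by apply: c1; rewrite k0.
    have [k1|k1] /= := eqVneq k 1; first by apply: c1; rewrite k1.
    have [k2|k2] /= := eqVneq k 2; last by rewrite addnC.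
    apply: (@coprime_opp _ _ 2); first by rewrite k2 in dk; rewrite add0n k2.
    by rewrite coprimen2 po //; case: pE => // p2; rewrite p2 k2 in kp.
  - by move=> i it; split; lia.
  - by move=> i it; rewrite !inE; split; lia.
  - move=> i it; rewrite /a0; do ?case: eqVneq => ?; try lia.
    by apply: (congr1 (modn^~ n)); lia.
  by exists a, nz; split=> //; split=> //; rewrite sz /=; lia.
have [on|en] := boolP (odd n).
  have [rest [sr er rI rs]] := rest_columns n0 M3 Mn.
  have [a [nz [[aI U A sz] [_ _ G]]]] := swap _ rs n (or_introl erefl) (fun=> on).
  rewrite -sz; apply: (@base_HWP n M (a :: rest)) => //=; first by case.
  move=> k kn; rewrite (@good_sum_eq n nz _ (fun k => a k + base_sum rest k)) ?base_sum_cons //.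
  by apply: G => //; rewrite neq_ltn kn.
have rs k : k < n -> n %| (2 * (n - k) + k) + k.
  by move=> kn; rewrite (_ : _ + k = 2 * n) ?dvdn_mull //; lia.
have n2_odd : 2 = n -> odd n by lia.
have [a [nz [[aI U A sz] [sub ea G]]]] := swap _ rs 2 (or_intror erefl) n2_odd.
(* M is even here, hence at least 4. The first two columns are equal, so rows 2 and 1 have the same
   difference 1 in both and can be switched. *)
have bs k : base_sum [:: subn n; subn n; a; id] k = a k + (2 * (n - k) + k).
  by rewrite !base_sum_cons base_sum0; lia.
rewrite -sz; apply: (@base_switched_HWP n M [:: subn n; subn n; a; id] _ _ _ _ _ nz 2 1) => //=.
- lia.
- lia.
- by case=> [|[|[|[|i]]]] //= _; try exact: col_inj_oppid; exact: col_inj_id.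
- by apply: sub.
- by apply: sub.
- rewrite bs ea // (@gcdn_opp n _ 2); first by rewrite -dvdn2 in en; rewrite gcdnC; apply/gcdn_idPl.
  by rewrite /a0 /= (_ : _ + 2 = 2 * n) ?dvdn_mull //; lia.
- lia.
- by apply: (congr1 (modn^~ n)); lia.
- by move=> k kn k2; rewrite (@good_sum_eq n nz _ (fun k => a k + (2 * (n - k) + k)) k (bs k)); exact: G.
Qed.

(** * Three-column matrices: M odd and n = 2 h *)

Section OddCycleEvenOrder.
Variables (h M : nat).
Hypothesis M_ge3 : 2 < M.
Hypothesis M_odd : odd M.
Let n := 2 * h.

(* A permutation of Z_n with 2 k - half_double k equal to 0 or -1. *)
Definition half_double k := if k < h then 2 * k else (2 * (k - h)).+1.

Lemma three_columns_sum (a psi : nat -> nat) k :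
  base_sum [:: id; a; fun k => n - psi k] k = a k + (k + (n - psi k)).
Proof. by rewrite !base_sum_cons base_sum0; lia. Qed.

(** For n even, -2 k is no permutation of Z_n; it is replaced by -psi(k) with psi close to
    [half_double]. In the applications a is the identity on the lower half and mostly k + 1 on the
    upper half, where the sum would otherwise be -1. The rows where this shift starts and where it
    wraps around keep nonzero sums and go into [nz]. *)
Lemma three_columns_HWP (a psi : nat -> nat) (nz : seq nat) (t y : nat) (e e' : nat -> nat) :
  0 < h -> col_inj n a -> col_inj n (fun k => n - psi k) -> uniq nz -> all (gtn n) nz ->
  (forall k, k < n -> good_sum n nz (fun k => a k + (k + (n - psi k))) k) ->
  (forall i, i < t -> e i < n /\ e' i < n) ->
  (forall i, i < t -> e i \notin nz /\ e' i \notin nz) ->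
  (forall i, i < t -> a (e' i) = (a (e i)).+1 %[mod n]) ->
  (forall i j, i < t -> j < t -> e i != e' j) ->
  (forall i j, i < j -> j < t -> e i != e j /\ e' i != e' j) ->
  size nz <= y <= size nz + 2 * t -> ~~ odd (y - size nz) ->
  HWP (lexC M n) M (M * n) (n - y) y.
Proof.
move=> h0 aI cI U A G en enz ea ee' ee /andP [y1 y2] oy.
have n0 : 0 < n by rewrite /n; lia.
have [|||a' [nz' [[aI' U' A' sz] [_ _ G']]]] :=
  @swap_pairs n a (fun k => k + (n - psi k)) nz n t e e' aI U A _ _ enz ea ee' ee
   (y - size nz)./2 _; try by lia.
- by move=> k kn _; exact: G.
- by move=> i it; have [e1 e2] := en i it; rewrite !neq_ltn e1 e2.
have -> : y = size nz' by rewrite sz; lia.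
apply: (@base_HWP n M [:: id; a'; fun k => n - psi k]) => //=.
- lia.
- by case=> [|[|[|i]]] //= _; exact: col_inj_id.
- move=> k kn; rewrite /good_sum three_columns_sum.
  by apply: G' => //; rewrite neq_ltn kn.
Qed.

(** Rows p and q are in [nz], so the exchanges leave their entries alone and the switch that repairs
    the sum -2 of row p stays available. *)
Lemma three_columns_switched_HWP (a psi : nat -> nat) (nz : seq nat) (p q t y : nat)
    (e e' : nat -> nat) :
  0 < h -> col_inj n a -> col_inj n (fun k => n - psi k) -> uniq nz -> all (gtn n) nz ->
  p \in nz -> q \in nz -> p != q -> odd (p + q) -> p + a q = q + a p ->
  n %| a p + (p + (n - psi p)) + 2 ->
  (forall k, k < n -> k != p -> good_sum n nz (fun k => a k + (k + (n - psi k))) k) ->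
  (forall i, i < t -> e i < n /\ e' i < n) ->
  (forall i, i < t -> e i \notin nz /\ e' i \notin nz) ->
  (forall i, i < t -> a (e' i) = (a (e i)).+1 %[mod n]) ->
  (forall i j, i < t -> j < t -> e i != e' j) ->
  (forall i j, i < j -> j < t -> e i != e j /\ e' i != e' j) ->
  size nz <= y <= size nz + 2 * t -> ~~ odd (y - size nz) ->
  HWP (lexC M n) M (M * n) (n - y) y.
Proof.
move=> h0 aI cI U A pin qin npq opq Epq gp G en enz ea ee' ee /andP [y1 y2] oy.
have n0 : 0 < n by rewrite /n; lia.
have [||a' [nz' [[aI' U' A' sz] [sub eqa G']]]] :=
  @swap_pairs n a (fun k => k + (n - psi k)) nz p t e e' aI U A G _ enz ea ee' ee
   (y - size nz)./2 _; try by lia.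
- move=> i it; have [e1 e2] := en i it; have [z1 z2] := enz i it; split => //.
  + by apply: contraNneq z1 => ->.
  + by apply: contraNneq z2 => ->.
have -> : y = size nz' by rewrite sz; lia.
apply: (@base_switched_HWP n M [:: id; a'; fun k => n - psi k] _ _ _ _ _ _ p q) => //=.
- lia.
- by case=> [|[|[|i]]] //= _; exact: col_inj_id.
- exact: sub.
- exact: sub.
- by rewrite oddM.
- by rewrite three_columns_sum eqa // (gcdn_opp gp) /n gcdnC; apply/gcdn_idPl; rewrite dvdn_mulr.
- by rewrite !eqa // Epq.
- by move=> k kn kp; rewrite /good_sum three_columns_sum; exact: G'.
Qed.

Lemma half_double_lt k : k < n -> half_double k < n.
Proof. by rewrite /half_double /n => ?; case: ifP => ?; lia. Qed.

Lemma half_double_inj k k' : half_double k = half_double k' -> k = k'.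
Proof. by rewrite /half_double; do 2!case: ifP => ?; lia. Qed.

Lemma coprime_n1 X : n %| X.+1 -> coprime n X.
Proof. by rewrite -addn1 => dX; apply: coprime_opp dX _; exact: coprimen1. Qed.

Lemma coprime_1n X m : X = (m * n).+1 -> coprime n X.
Proof. by move=> ->; rewrite /coprime -addn1 gcdnMDl gcdn1. Qed.

Lemma dvd_eq X m : X = m * n -> n %| X.
Proof. by move=> ->; exact: dvdn_mull. Qed.

Lemma coprime_h1 : ~~ odd h -> 0 < h -> coprime n (h - 1).
Proof.
move=> eh h0; rewrite /n coprimeMl coprime2n.
have -> : odd (h - 1) by lia.
by have := coprimenS (h - 1); rewrite coprime_sym (_ : (h - 1).+1 = h) //; lia.
Qed.

Lemma coprime_h2 : odd h -> 2 < h -> coprime n (h - 2).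
Proof.
move=> oh h2; rewrite /n coprimeMl coprime2n.
have o2 : odd (h - 2) by lia.
rewrite o2 /= -{1}(subnKC (ltnW h2)) /coprime gcdnC gcdnDr.
by rewrite -/(coprime _ _) coprimen2.
Qed.

(* Nonzero row sums before the exchanges: -1 in row h, -(h - 1) in row n - 1. *)
Lemma HWP_h_even_y_even y : ~~ odd h -> 0 < h -> ~~ odd y -> 2 <= y <= n ->
  HWP (lexC M n) M (M * n) (n - y) y.
Proof.
move=> eh h0 ey yn; have En : n = 2 * h by [].
pose a k := if k <= h then k else if k < n - 1 then k.+1 else h.+1.
(* The h - 1 pairs fill the rows 0, .., h - 1 and h + 1, .., n - 2; on both ranges a advances by
   one. *)
apply: (@three_columns_HWP a half_double [:: h; n - 1] (h - 1) _
  (fun i => if i < h./2 then 2 * i else h.+1 + 2 * (i - h./2))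
  (fun i => if i < h./2 then (2 * i).+1 else h.+2 + 2 * (i - h./2))) => //.
- by apply: col_inj_lt => [k ?|k k' ? ?]; rewrite /a; do ?case: ifP => ?; lia.
- by apply: col_inj_opp => [k|k k' _ _]; [exact: half_double_lt | exact: half_double_inj].
- by rewrite /= inE andbT; lia.
- by rewrite /= andbT; lia.
- move=> k kn; rewrite /good_sum !inE /a /half_double.
  have [kh|kh] /= := eqVneq k h.
    by apply: coprime_n1; apply: (@dvd_eq _ 2); do ?case: ifP => ?; lia.
  have [kn1|kn1] /= := eqVneq k (n - 1).
    apply: coprime_opp (coprime_h1 eh h0).
    by apply: (@dvd_eq _ 2); do ?case: ifP => ?; lia.
  have /orP [kh'|kh'] : (k < h) || (h < k) by lia.
    by apply: (@dvd_eq _ 1); do ?case: ifP => ?; lia.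
  by apply: (@dvd_eq _ 2); do ?case: ifP => ?; lia.
- by move=> i ih; do ?case: ifP => ?; lia.
- by move=> i ih; rewrite !inE; do ?case: ifP => ?; lia.
- by move=> i ih; case: ifP => ?; apply: (congr1 (modn^~ n)); rewrite /a; do ?case: ifP => ?; lia.
- by move=> i j ih jh; do ?case: ifP => ?; lia.
- by move=> i j ij jh; do ?case: ifP => ?; lia.
- by rewrite /=; lia.
- by rewrite /=; lia.
Qed.

(* Nonzero row sums before the exchanges: -1 in rows h and h + 1, -(h - 2) in
   row n - 1. *)
Lemma HWP_h_odd_y_odd y : odd h -> 2 < h -> odd y -> 3 <= y <= n ->
  HWP (lexC M n) M (M * n) (n - y) y.
Proof.
move=> oh h3 oy yn; have En : n = 2 * h by [].
pose a k := if k <= h.+1 then k else if k < n - 1 then k.+1 else h.+2.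
(* Row h - 1 stays unpaired: y is odd, so at most n - 1 = 3 + 2 (h - 2). *)
apply: (@three_columns_HWP a half_double [:: h; h.+1; n - 1] (h - 2) _
  (fun i => if i < h./2 then 2 * i else h.+2 + 2 * (i - h./2))
  (fun i => if i < h./2 then (2 * i).+1 else h.+3 + 2 * (i - h./2))) => //.
- lia.
- by apply: col_inj_lt => [k ?|k k' ? ?]; rewrite /a; do ?case: ifP => ?; lia.
- by apply: col_inj_opp => [k|k k' _ _]; [exact: half_double_lt | exact: half_double_inj].
- by rewrite /= !inE andbT; lia.
- by rewrite /= andbT; lia.
- move=> k kn; rewrite /good_sum !inE /a /half_double.
  have [kh|kh] /= := eqVneq k h.
    by apply: coprime_n1; apply: (@dvd_eq _ 2); do ?case: ifP => ?; lia.
  have [kh1|kh1] /= := eqVneq k h.+1.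
    by apply: coprime_n1; apply: (@dvd_eq _ 2); do ?case: ifP => ?; lia.
  have [kn1|kn1] /= := eqVneq k (n - 1).
    apply: coprime_opp (coprime_h2 oh h3).
    by apply: (@dvd_eq _ 2); do ?case: ifP => ?; lia.
  have /orP [kh'|kh'] : (k < h) || (h < k) by lia.
    by apply: (@dvd_eq _ 1); do ?case: ifP => ?; lia.
  by apply: (@dvd_eq _ 2); do ?case: ifP => ?; lia.
- by move=> i ih; do ?case: ifP => ?; lia.
- by move=> i ih; rewrite !inE; do ?case: ifP => ?; lia.
- by move=> i ih; case: ifP => ?; apply: (congr1 (modn^~ n)); rewrite /a; do ?case: ifP => ?; lia.
- by move=> i j ih jh; do ?case: ifP => ?; lia.
- by move=> i j ij jh; do ?case: ifP => ?; lia.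
- by rewrite /=; lia.
- by rewrite /=; lia.
Qed.

(* Nonzero row sums before the exchanges: 1 in row 1, -2 in row h, -(h - 1) in
   row n - 1; rows 1 and h differ by h - 1 in the first two columns. *)
Lemma HWP_h_even_y_odd y : ~~ odd h -> 0 < h -> odd y -> 3 <= y <= n ->
  HWP (lexC M n) M (M * n) (n - y) y.
Proof.
move=> eh h0 oy yn; have En : n = 2 * h by [].
pose a k := if k <= h then k else if k < n - 1 then k.+1 else h.+1.
(* Swapping the values of [half_double] in rows 1 and h turns their sums 0 and -1 into 1 and -2. *)
pose psi k := if k == 1 then 1 else if k == h then 2 else half_double k.
apply: (@three_columns_switched_HWP a psi [:: 1; h; n - 1] h 1 (h - 2) _
  (fun i => if i < h./2 - 1 then 2 * i + 2 else h.+1 + 2 * (i - (h./2 - 1)))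
  (fun i => if i < h./2 - 1 then 2 * i + 3 else h.+2 + 2 * (i - (h./2 - 1)))) => //.
- by apply: col_inj_lt => [k ?|k k' ? ?]; rewrite /a; do ?case: ifP => ?; lia.
- by apply: col_inj_opp => [k ?|k k' ? ?]; rewrite /psi /half_double; do ?case: ifP => ?; lia.
- by rewrite /= !inE andbT; lia.
- by rewrite /= andbT; lia.
- by rewrite !inE eqxx orbT.
- lia.
- lia.
- by rewrite /a; do ?case: ifP => ?; lia.
- by apply: (@dvd_eq _ 2); rewrite /a /psi; do ?case: ifP => ?; lia.
- move=> k kn kh; rewrite /good_sum !inE (negPf kh) /a /psi /half_double.
  have [k1|k1] /= := eqVneq k 1.
    by apply: (@coprime_1n _ 1); do ?case: ifP => ?; lia.
  have [kn1|kn1] /= := eqVneq k (n - 1).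
    apply: coprime_opp (coprime_h1 eh h0).
    by apply: (@dvd_eq _ 2); do ?case: ifP => ?; lia.
  have /orP [kh'|kh'] : (k < h) || (h < k) by lia.
    by apply: (@dvd_eq _ 1); do ?case: ifP => ?; lia.
  by apply: (@dvd_eq _ 2); do ?case: ifP => ?; lia.
- by move=> i ih; do ?case: ifP => ?; lia.
- by move=> i ih; rewrite !inE; do ?case: ifP => ?; lia.
- by move=> i ih; case: ifP => ?; apply: (congr1 (modn^~ n)); rewrite /a; do ?case: ifP => ?; lia.
- by move=> i j ih jh; do ?case: ifP => ?; lia.
- by move=> i j ij jh; do ?case: ifP => ?; lia.
- by rewrite /=; lia.
- by rewrite /=; lia.
Qed.

(* Nonzero row sums before the exchanges: 1 in row 1, -1 in row h - 1, -2 in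
   row h, -(h - 2) in row n - 2. *)
Lemma HWP_h_odd_y_even y : odd h -> 2 < h -> ~~ odd y -> 4 <= y <= n ->
  HWP (lexC M n) M (M * n) (n - y) y.
Proof.
move=> oh h3 ey yn; have En : n = 2 * h by [].
pose a k := if k <= h then k else if k < n - 2 then k.+1 else if k == n - 2 then h.+1 else k.
(* Values of [half_double] are swapped between rows 1 and h and between rows h - 1 and n - 1. The
   second swap gives row h - 1 the sum -1, and row n - 1 the sum 0 with a fixing n - 1. *)
pose psi k := if k == 1 then 1 else if k == h - 1 then n - 1 else if k == h then 2
              else if k == n - 1 then n - 2 else half_double k.
(* Rows h and h - 1 differ by 1 in the first two columns. The pair (n - 1, 0) is consecutive modulo
   n; with it the pairs use up all rows outside [nz], as y = n demands. *)
apply: (@three_columns_switched_HWP a psi [:: 1; h - 1; h; n - 2] h (h - 1) (h - 2) _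
  (fun i => if i == 0 then n - 1 else if i < h./2 then 2 * i else h.+1 + 2 * (i - h./2))
  (fun i => if i == 0 then 0 else if i < h./2 then (2 * i).+1 else h.+2 + 2 * (i - h./2))) => //.
- lia.
- by apply: col_inj_lt => [k ?|k k' ? ?]; rewrite /a; do ?case: ifP => ?; lia.
- by apply: col_inj_opp => [k ?|k k' ? ?]; rewrite /psi /half_double; do ?case: ifP => ?; lia.
- by rewrite /= !inE andbT; lia.
- by rewrite /= andbT; lia.
- by rewrite !inE eqxx !orbT.
- by rewrite !inE eqxx !orbT.
- lia.
- lia.
- by rewrite /a; do ?case: ifP => ?; lia.
- by apply: (@dvd_eq _ 2); rewrite /a /psi; do ?case: ifP => ?; lia.
- move=> k kn kh; rewrite /good_sum !inE (negPf kh) /a /psi /half_double.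
  have [k1|k1] /= := eqVneq k 1.
    by apply: (@coprime_1n _ 1); do ?case: ifP => ?; lia.
  have [kh1|kh1] /= := eqVneq k (h - 1).
    by apply: coprime_n1; apply: (@dvd_eq _ 1); do ?case: ifP => ?; lia.
  have [kn2|kn2] /= := eqVneq k (n - 2).
    apply: coprime_opp (coprime_h2 oh h3).
    by apply: (@dvd_eq _ 2); do ?case: ifP => ?; lia.
  have /orP [kh'|kh'] : (k < h) || (h < k) by lia.
    by apply: (@dvd_eq _ 1); do ?case: ifP => ?; lia.
  by apply: (@dvd_eq _ 2); do ?case: ifP => ?; lia.
- by move=> i ih; do ?case: ifP => ?; lia.
- by move=> i ih; rewrite !inE; do ?case: ifP => ?; lia.
- move=> i ih; case: ifP => ?.
    have -> : a 0 = 0 by rewrite /a.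
    have -> : (a (n - 1)).+1 = n by rewrite /a; do ?case: ifP => ?; lia.
    by rewrite modnn mod0n.
  by case: ifP => ?; apply: (congr1 (modn^~ n)); rewrite /a; do ?case: ifP => ?; lia.
- by move=> i j ih jh; do ?case: ifP => ?; lia.
- by move=> i j ij jh; do ?case: ifP => ?; lia.
- by rewrite /=; lia.
- by rewrite /=; lia.
Qed.

End OddCycleEvenOrder.

(** Three identity columns have row sums 0 and 3, which settles y = 1; for y = 2 the two cycles of
    row 0 are merged by switching with row 1. *)
Lemma HWP_order2 M y : 2 < M -> odd M -> 0 < y <= 2 ->
  HWP (lexC M 2) M (M * 2) (2 - y) y.
Proof.
move=> M3 oM; case: y => [|[|[|y]]] // _.
- apply: (@base_HWP 2 M [:: id; id; id] _ _ _ _ _ [:: 1]) => //=; first by lia.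
  + by case=> [|[|[|i]]] //= _; exact: col_inj_id.
  + by case=> [|[|k]] // _; rewrite /good_sum !base_sum_cons base_sum0.
- apply: (@base_switched_HWP 2 M [:: id; id; id] _ _ _ _ _ [:: 0; 1] 0 1) => //=; first by lia.
  + by case=> [|[|[|i]]] //= _; exact: col_inj_id.
  + by rewrite !base_sum_cons base_sum0.
  + by case=> [|[|k]] // _ _; rewrite /good_sum !base_sum_cons base_sum0.
Qed.

(** * Transversal designs with four groups *)

(* A block is the tuple of its points b 0, .., b 3, one in each of four copies
   of T; the values b c with c > 3 are irrelevant. *)
Definition is_TD4 (T : Type) (B : (nat -> T) -> Prop) : Prop :=
  (forall x y, exists b, [/\ B b, b 0 = x & b 1 = y]) /\
  (forall b b' c c', B b -> B b' -> c < 4 -> c' < 4 -> c != c' ->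
     b c = b' c -> b c' = b' c' -> forall e, e < 4 -> b e = b' e).

Definition TD4 (T : Type) : Prop := exists B, @is_TD4 T B.

(** The constant block at x is the one that Wilson's construction leaves out. *)
Definition pointed_TD4 (T : Type) (x : T) : Prop :=
  exists B, is_TD4 B /\ exists b, B b /\ forall c, c < 4 -> b c = x.

Lemma pointed_TD4_bij (T T' : Type) (f : T -> T') x :
  bijective f -> pointed_TD4 x -> pointed_TD4 (f x).
Proof.
case=> g fK gK [B [[Bex Buniq] [b0 [Bb0 b0x]]]].
exists (fun b => exists b1, B b1 /\ forall c, b c = f (b1 c)); split; first split.
- move=> y z; have [b [Bb b_0 b_1]] := Bex (g y) (g z).
  by exists (fun c => f (b c)); split; rewrite ?b_0 ?b_1 ?gK //; exists b.
- move=> b b' c c' [b1 [B1 E1]] [b1' [B1' E1']] c4 c4' cc'.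
  rewrite !E1 !E1' => /(can_inj fK) e1 /(can_inj fK) e2 e e4; rewrite E1 E1'; congr f.
  exact: (Buniq b1 b1' c c').
- by exists (fun c => f (b0 c)); split=> [|c c4]; [exists b0 | rewrite b0x].
Qed.

Lemma TD4_bij (T T' : Type) (f : T -> T') : bijective f -> TD4 T -> TD4 T'.
Proof.
case=> g fK gK [B [Bex Buniq]].
exists (fun b => exists b1, B b1 /\ forall c, b c = f (b1 c)); split.
- move=> y z; have [b [Bb b_0 b_1]] := Bex (g y) (g z).
  by exists (fun c => f (b c)); split; rewrite ?b_0 ?b_1 ?gK //; exists b.
- move=> b b' c c' [b1 [B1 E1]] [b1' [B1' E1']] c4 c4' cc'.
  rewrite !E1 !E1' => /(can_inj fK) e1 /(can_inj fK) e2 e e4; rewrite E1 E1'; congr f.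
  exact: (Buniq b1 b1' c c').
Qed.

Lemma TD4_card (T T' : finType) : #|T| = #|T'| -> TD4 T -> TD4 T'.
Proof.
move=> eqc; apply: (@TD4_bij _ _ (fun x => enum_val (cast_ord eqc (enum_rank x)))).
exists (fun x => enum_val (cast_ord (esym eqc) (enum_rank x))) => x.
  by rewrite enum_valK cast_ordK enum_rankK.
by rewrite enum_valK cast_ordKV enum_rankK.
Qed.

Lemma TD4_prod (T T' : Type) : TD4 T -> TD4 T' -> TD4 (T * T').
Proof.
case=> B [Bex Buniq] [B' [Bex' Buniq']].
exists (fun b => exists b1 b2, [/\ B b1, B' b2 & forall c, b c = (b1 c, b2 c)]); split.
  move=> [x x'] [y y']; have [b [Bb b0 b1]] := Bex x y.
  have [b' [Bb' b0' b1']] := Bex' x' y'.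
  exists (fun c => (b c, b' c)); rewrite b0 b1 b0' b1'; split=> //.
  by exists b, b'.
move=> b b' c c' [b1 [b2 [B1 B2 Eb]]] [b1' [b2' [B1' B2' Eb']]] c4 c4' cc'.
rewrite !Eb !Eb' => -[e1 e2] [e1' e2'] e e4.
by rewrite Eb Eb' (Buniq b1 b1' c c') // (Buniq' b2 b2' c c').
Qed.

(* The c-th point of the line (i, j): i + sl c * j, with slope infinity at c = 1. *)
Definition lin (V : zmodType) (sl : nat -> nat) (i j : V) (c : nat) : V :=
  if c == 1 then j else (i + j *+ sl c)%R.

(** * Designs from lines over abelian groups *)

Section Lines.
Import GRing.Theory.
Local Open Scope ring_scope.
Variables (V : zmodType) (D : nat) (sl : nat -> nat) (N : nat).
Hypothesis torsion_free : forall d (x : V), (0 < d < D)%N -> x *+ d = 0 -> x = 0.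
Hypothesis sl_lt : forall c, (c < N)%N -> (sl c < D)%N.
Hypothesis sl_inj : forall c c', (c < N)%N -> (c' < N)%N -> c != 1%N -> c' != 1%N ->
  sl c = sl c' -> c = c'.

(** Subtracting the points at two finite slopes eliminates i and leaves j times a slope difference
    between 0 and D, which can be cancelled; slope infinity gives j at once. *)
Lemma lin_uniq (i j i' j' : V) c c' : (c < N)%N -> (c' < N)%N -> c != c' ->
  lin sl i j c = lin sl i' j' c -> lin sl i j c' = lin sl i' j' c' -> i = i' /\ j = j'.
Proof.
wlog le_sl : c c' / (c == 1%N) || (c' != 1%N) && (sl c <= sl c')%N => [H|].
  move=> cN cN' cc' e1 e2.
  have [c1|c1] := eqVneq c 1%N; first by apply: (H c c') => //; rewrite c1.
  have [c1'|c1'] := eqVneq c' 1%N; first by apply: (H c' c) => //; rewrite ?c1' // eq_sym.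
  have [le|/ltnW le] := leqP (sl c) (sl c').
    by apply: (H c c') => //; rewrite c1' le orbT.
  by apply: (H c' c) => //; rewrite ?c1 ?le ?orbT // eq_sym.
rewrite /lin => cN cN' cc'; case/orP: le_sl => [c1 | /andP [c1' le]].
  have /negPf -> : c' != 1%N by rewrite eq_sym -(eqP c1).
  by rewrite c1 => -> /addIr ->.
have [_|c1] := eqVneq c 1%N; first by move=> ->; rewrite (negPf c1') => /addIr ->.
rewrite (negPf c1') => e1 e2.
have lt : (sl c < sl c')%N.
  rewrite ltn_neqAle le andbT; apply/eqP => es; case/eqP: cc'; exact: sl_inj.
have ej : j = j'.
  apply/eqP; rewrite -subr_eq0; apply/eqP/(torsion_free (d := sl c' - sl c)).
    by rewrite subn_gt0 lt /= (leq_ltn_trans (leq_subr _ _)) ?sl_lt.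
  have : (i + j *+ sl c') - (i + j *+ sl c) = (i' + j' *+ sl c') - (i' + j' *+ sl c).
    by rewrite e1 e2.
  rewrite !opprD [LHS]addrACA [RHS]addrACA !subrr !add0r -!mulrnBr // => e3.
  by rewrite mulrnBl e3 subrr.
by move: e1; rewrite ej => /addIr.
Qed.

End Lines.

Lemma TD4_lines (V : zmodType) :
  (forall d (x : V), 0 < d < 3 -> (x *+ d = 0)%R -> x = 0%R) -> TD4 V.
Proof.
(* The slopes are 0, infinity, 1, 2; the entry at index 1 is a placeholder. *)
move=> tf; pose sl c := nth 0 [:: 0; 0; 1; 2] c.
exists (fun b => exists i j, forall c, b c = lin sl i j c); split.
  by move=> x y; exists (lin sl x y); split; rewrite /lin //= ?GRing.addr0 //; exists x, y.
move=> b b' c c' [i [j Eb]] [i' [j' Eb']] c4 c4' cc'; rewrite !Eb !Eb' => e1 e2 e _.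
suff [ei ej] : i = i' /\ j = j' by rewrite Eb Eb' ei ej.
apply: (lin_uniq (D := 3) (N := 4) tf _ _ c4 c4' cc' e1 e2).
  by case=> [|[|[|[|]]]].
by case=> [|[|[|[|a]]]] // [|[|[|[|a']]]].
Qed.

Lemma ord_torsion_free (m D d : nat) (x : 'I_m.+1) :
  (forall d, 0 < d < D -> coprime m.+1 d) ->
  0 < d < D -> (x *+ d = 0)%R -> x = 0%R.
Proof.
move=> cop dD /(congr1 val); rewrite Zp_mulrn /= => /eqP.
rewrite -/(m.+1 %| x * d) Gauss_dvdl ?cop // => dv; apply: val_inj => /=.
by apply/eqP; rewrite -leqn0 leqNgt; apply/negP => x0; have := dvdn_leq x0 dv; rewrite leqNgt ltn_ord.
Qed.

Lemma TD4_odd n : odd n -> TD4 'I_n.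
Proof.
case: n => // m on; apply: TD4_lines => d x; apply: ord_torsion_free => d'.
by case: d' => [|[|[|d']]] // _; rewrite ?coprimen1 ?coprimen2.
Qed.

(* Wilson's construction: a transversal design TD(5, V) truncated on its last
   group to U; a block is inflated by a TD(4, E), or, if it meets U, by a
   TD(4, E + 1) less one block. *)
Section Wilson.
Variables (V : zmodType) (U : pred V) (E : Type).
Hypothesis tf : forall d (x : V), 0 < d < 4 -> (x *+ d = 0)%R -> x = 0%R.
Hypothesis TDE : TD4 E.
Hypothesis TDO : pointed_TD4 (None : option E).
Hypothesis TDU : TD4 {w : V | U w}.

(** Slope 1 sits on the truncated group 4, so a line can be solved for from its point there and one
    of i and j. *)
Let sl c := nth 0 [:: 0; 0; 2; 3; 1] c.
Notation W := {w : V | U w}.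

Let lin5_uniq (i j i' j' : V) c c' : c < 5 -> c' < 5 -> c != c' ->
  lin sl i j c = lin sl i' j' c -> lin sl i j c' = lin sl i' j' c' -> i = i' /\ j = j'.
Proof.
move=> c5 c5' cc'; apply: (lin_uniq (D := 4) (N := 5) tf) => //.
  by case=> [|[|[|[|[|]]]]].
by case=> [|[|[|[|[|a]]]]] // [|[|[|[|[|a']]]]].
Qed.

(** [None] stands for the point of the line on group 4, which serves as an extra point of each of
    the four groups. *)
Definition inflate (i j : V) (bo : nat -> option E) (c : nat) (q : V * E + W) : Prop :=
  match q with
  | inl (v, e) => v = lin sl i j c /\ bo c = Some e
  | inr w => val w = lin sl i j 4 /\ bo c = None
  end.

Lemma inflate_fun i j bo c q q' : inflate i j bo c q -> inflate i j bo c q' -> q = q'.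
Proof.
case: q => [[v e]|w]; case: q' => [[v' e']|w'] /= [e1 E1] [e2 E2]; rewrite E1 // in E2.
  by rewrite e1 e2; case: E2 => ->.
by congr inr; apply: val_inj; rewrite /= e1 e2.
Qed.

Theorem TD4_wilson : TD4 ((V * E) + W).
Proof.
have [BE [BEex BEuniq]] := TDE.
have [BO [[BOex BOuniq] [b0 [Bb0 b0N]]]] := TDO.
have [BU [BUex BUuniq]] := TDU.
(* Two values [None] already force the constant block, so entries 0 and 1 are enough to exclude
   it. *)
pose K (z : V) (bo : nat -> option E) :=
  if U z then BO bo /\ (bo 0 <> None \/ bo 1 <> None)
  else exists be, BE be /\ forall c, bo c = Some (be c).
have K_uniq z bo bo' c c' : K z bo -> K z bo' -> c < 4 -> c' < 4 -> c != c' ->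
    bo c = bo' c -> bo c' = bo' c' -> forall e, e < 4 -> bo e = bo' e.
  rewrite /K; case: (U z) => [[B1 _] [B2 _] | [be [B1 E1]] [be' [B2 E2]]].
    exact: BOuniq.
  move=> c4 c4' cc'; rewrite !E1 !E2 => -[e1] [e2] e e4; rewrite E1 E2.
  by congr Some; apply: (BEuniq be be' c c').
have K_None z bo c c' : K z bo -> c < 4 -> c' < 4 -> c != c' ->
    bo c = None -> bo c' = None -> False.
  rewrite /K; case: (U z) => [[B1 nN] | [be [_ E1]]]; last by rewrite E1.
  move=> c4 c4' cc' e1 e2.
  have H e : e < 4 -> bo e = None.
    by move=> e4; rewrite -(b0N e e4); apply: (BOuniq bo b0 c c') => //; rewrite b0N.
  by case: nN; rewrite H.
pose BA b := exists i j bo, K (lin sl i j 4) bo /\ forall c, inflate i j bo c (b c).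
pose BW (b : nat -> V * E + W) := exists bu, BU bu /\ forall c, b c = inr (bu c).
have BA_W b c c' w w' : BA b -> c < 4 -> c' < 4 -> c != c' ->
    b c = inr w -> b c' = inr w' -> False.
  case=> i [j [bo [Kb Hb]]] c4 c4' cc' e1 e2.
  have := Hb c; rewrite e1 => -[_ n1]; have := Hb c'; rewrite e2 => -[_ n2].
  exact: (K_None _ _ c c' Kb).
have BA_U i j (w : W) o0 o1 : val w = lin sl i j 4 -> o0 <> None \/ o1 <> None ->
    exists b, [/\ BA b, inflate i j (fun=> o0) 0 (b 0) & inflate i j (fun=> o1) 1 (b 1)].
  move=> Ew no; have [bo [Bbo e0 e1]] := BOex o0 o1.
  pose b c : V * E + W := if bo c is Some e then inl (lin sl i j c, e) else inr w.
  have Hb c : inflate i j bo c (b c) by rewrite /b; case Eb: (bo c).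
  exists b; split.
  - exists i, j, bo; split=> //; rewrite /K -Ew (valP w); split=> //.
    by rewrite e0 e1.
  - by have := Hb 0; rewrite /b /inflate -e0; case: (bo 0).
  - by have := Hb 1; rewrite /b /inflate -e1; case: (bo 1).
exists (fun b => BA b \/ BW b); split.
- move=> [[v e]|w] [[v' e']|w'].
  + case Uz: (U (lin sl v v' 4)).
      have [|b [Ab H0 H1]] := @BA_U v v' (exist _ _ Uz) (Some e) (Some e') erefl _; first by left.
      exists b; split; first by left.
        by apply: inflate_fun H0 _; rewrite /inflate /lin /= GRing.addr0.
      by apply: inflate_fun H1 _; rewrite /inflate /lin.
    have [be [Bbe e0 e1]] := BEex e e'.
    exists (fun c => inl (lin sl v v' c, be c)); split.
    * left; exists v, v', (fun c => Some (be c)); split => //.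
      by rewrite /K Uz; exists be.
    * by rewrite e0 /lin /= GRing.addr0.
    * by rewrite e1 /lin.
  + have Ew : val w' = lin sl v (val w' - v)%R 4.
      by rewrite /lin /= GRing.mulr1n GRing.addrC GRing.subrK.
    have [|b [Ab H0 H1]] := @BA_U v _ w' (Some e) None Ew _; first by left.
    exists b; split; first by left.
      by apply: inflate_fun H0 _; rewrite /inflate /lin /= GRing.addr0.
    by apply: inflate_fun H1 _; rewrite /inflate.
  + have Ew : val w = lin sl (val w - v')%R v' 4.
      by rewrite /lin /= GRing.mulr1n GRing.subrK.
    have [|b [Ab H0 H1]] := @BA_U _ v' w None (Some e') Ew _; first by right.
    exists b; split; first by left.
      by apply: inflate_fun H0 _; rewrite /inflate.
    by apply: inflate_fun H1 _; rewrite /inflate /lin.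
  + have [bu [Bbu e0 e1]] := BUex w w'.
    exists (fun c => inr (bu c)); split; rewrite ?e0 ?e1 //.
    by right; exists bu.
- move=> b b' c c' Bb Bb' c4 c4' cc' e1 e2 e e4.
  case: Bb => [Ab|[bu [Bbu Eb]]]; last first.
    case: Bb' => [Ab'|[bu' [Bbu' Eb']]].
      by case: (BA_W b' c c' (bu c) (bu c')) => //; rewrite -?e1 -?e2 Eb.
    rewrite !Eb !Eb' in e1 e2 *; case: e1 => e1; case: e2 => e2.
    by congr inr; apply: (BUuniq bu bu' c c').
  case: Bb' => [Ab'|[bu' [Bbu' Eb']]]; last first.
    by case: (BA_W b c c' (bu' c) (bu' c')) => //; rewrite ?e1 ?e2 Eb'.
  case: (Ab) => i [j [bo [Kb Hb]]]; case: Ab' => i' [j' [bo' [Kb' Hb']]].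
  (* [ch a] is the group of the TD(5, V) on which the a-th point of the block is seen: 4 for points
     of W. Two distinct such groups determine the line. *)
  pose ch a := if b a is inl _ then a else 4.
  have agree a : a < 4 -> b a = b' a ->
      lin sl i j (ch a) = lin sl i' j' (ch a) /\ bo a = bo' a.
    move=> a4 ea; have := Hb a; have := Hb' a; rewrite -ea /ch.
    by case: (b a) => [[v u]|w] /= [<- ->] [<- ->].
  have ch5 a : a < 4 -> ch a < 5 by rewrite /ch; case: (b a) => //; lia.
  have chc : ch c != ch c'.
    rewrite /ch; case Ec: (b c) => [x|w]; case Ec': (b c') => [x'|w'] //; try lia.
    by case: (BA_W b c c' w w').
  have [l1 o1] := agree c c4 e1; have [l2 o2] := agree c' c4' e2.
  have [ei ej] := lin5_uniq (ch5 _ c4) (ch5 _ c4') chc l1 l2.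
  rewrite -ei -ej in Kb' Hb'.
  have eo := K_uniq _ _ _ _ _ Kb Kb' c4 c4' cc' o1 o2 e e4.
  apply: (inflate_fun (Hb e)); have := Hb' e.
  by rewrite /inflate eo.
Qed.

End Wilson.

(* Blocks over Z_m and the point m at infinity, developed modulo m from the
   quasi-difference matrix with columns (0, x, al_x, be_x), (0, m, a1, b1), (m, 0, a2, b2)
   and (m, m, m, m). *)
Definition qdm_block (m : nat) (al be : seq nat) (a1 b1 a2 b2 i j : nat) : seq nat :=
  let dev t x := if x == m then m else (t + x) %% m in
  if i == m then
    if j == m then [:: m; m; m; m] else [:: m; j; dev j a2; dev j b2]
  else if j == m then [:: i; m; dev i a1; dev i b1]
  else let x := (j + (m - i)) %% m in [:: i; j; dev i (nth 0 al x); dev i (nth 0 be x)].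

Definition agreements (s s' : seq nat) : nat :=
  (nth 0 s 0 == nth 0 s' 0) + (nth 0 s 1 == nth 0 s' 1)
  + (nth 0 s 2 == nth 0 s' 2) + (nth 0 s 3 == nth 0 s' 3).

Definition blocks_check (m : nat) (blk : nat -> nat -> seq nat) : bool :=
  let r := iota 0 m.+1 in
  let L := [seq blk i j | i <- r, j <- r] in
  [&& all (fun s => all (fun s' => (s == s') || (agreements s s' <= 1)) L) L,
      all (fun s => all (fun x => x <= m) s) L,
      all (fun i => all (fun j => (nth 0 (blk i j) 0 == i) && (nth 0 (blk i j) 1 == j)) r) r
    & blk m m == [:: m; m; m; m]].

Lemma TD4_of_blocks m blk : blocks_check m blk -> pointed_TD4 (@ord_max m).
Proof.
case/and4P=> /allP uL /allP leL /allP pL /eqP bm.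
set r := iota 0 m.+1 in uL leL pL; set L := [seq _ | _ <- _, _ <- _] in uL leL.
have inr (i : 'I_m.+1) : (i : nat) \in r by rewrite mem_iota /= ltn_ord.
have inL (i j : 'I_m.+1) : blk i j \in L by apply: allpairs_f; exact: inr.
have le_nth s c : s \in L -> nth 0 s c <= m.
  move=> sL; have [cs|cs] := ltnP c (size s); last by rewrite nth_default.
  by apply: (allP (leL s sL)); rewrite mem_nth.
pose B (b : nat -> 'I_m.+1) := exists2 s, s \in L & forall c, b c = nth 0 s c :> nat.
have mk s : s \in L -> B (fun c => inord (nth 0 s c)).
  by move=> sL; exists s => // c; rewrite inordK // ltnS le_nth.
exists B; split; first split.
- move=> i j; exists (fun c => inord (nth 0 (blk i j) c)).
  have /allP/(_ _ (inr j)) /andP [/eqP e0 /eqP e1] := pL _ (inr i).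
  by split; [exact: mk | rewrite e0 inord_val | rewrite e1 inord_val].
- move=> b b' c c' [s sL Es] [s' sL' Es'] c4 c4' cc' e1 e2 e e4.
  apply: val_inj; rewrite /= Es Es'.
  move/(congr1 val): e1 => /=; rewrite Es Es' => e1.
  move/(congr1 val): e2 => /=; rewrite Es Es' => e2.
  have /allP/(_ _ sL') /orP [/eqP -> //|] := uL _ sL.
  rewrite /agreements; move: c c' c4 c4' cc' e1 e2.
  by case=> [|[|[|[|?]]]] // [|[|[|[|?]]]] // _ _ _ -> ->; rewrite !eqxx; lia.
- exists (fun c => inord (nth 0 (blk m m) c)); split; first exact: mk (inL ord_max ord_max).
  move=> c c4; apply: val_inj; rewrite /= bm inordK.
    by case: c c4 => [|[|[|[|]]]].
  by case: c c4 => [|[|[|[|]]]] //= _; rewrite ltnSn.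
Qed.

(** * Designs of small even order *)

Lemma pointed_TD4_4 : pointed_TD4 (@ord_max 3).
Proof.
apply: (@TD4_of_blocks _ (qdm_block 3 [:: 2; 1; 3] [:: 0; 3; 1] 0 2 1 1)).
by vm_compute.
Qed.

Lemma pointed_TD4_TD4 T (x : T) : pointed_TD4 x -> TD4 T.
Proof. by case=> B [TB _]; exists B. Qed.

Lemma TD4_8 : TD4 'I_8.
Proof.
apply: pointed_TD4_TD4; apply: (@TD4_of_blocks _
  (qdm_block 7 [:: 4; 7; 5; 3; 2; 6; 1] [:: 1; 0; 4; 6; 2; 7; 3] 0 5 6 0)).
by vm_compute.
Qed.

Lemma TD4_10 : TD4 'I_10.
Proof.
apply: pointed_TD4_TD4; apply: (@TD4_of_blocks _
  (qdm_block 9 [:: 7; 3; 5; 2; 1; 0; 6; 9; 4] [:: 9; 0; 4; 6; 8; 3; 2; 7; 5] 8 1 1 1)).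
by vm_compute.
Qed.

Lemma TD4_14 : TD4 'I_14.
Proof.
apply: pointed_TD4_TD4; apply: (@TD4_of_blocks _
  (qdm_block 13 [:: 2; 5; 7; 6; 12; 4; 0; 3; 1; 10; 13; 11; 9]
    [:: 4; 13; 10; 1; 11; 5; 9; 3; 7; 2; 12; 8; 0] 8 6 11 5)).
by vm_compute.
Qed.

Lemma pointed_TD4_option3 : pointed_TD4 (None : option 'I_3).
Proof.
have <- : unlift ord_max (@ord_max 3) = None by rewrite unlift_none.
apply: pointed_TD4_bij pointed_TD4_4.
exists (fun o => if o is Some i then lift ord_max i else ord_max) => [i|[i|]].
- by case: unliftP.
- by rewrite liftK.
- by rewrite unlift_none.
Qed.

(** * Designs of all positive even orders except 2 and 6 *)

Lemma TD4_truncation t u : coprime t 6 -> odd u -> u <= t -> TD4 'I_(3 * t + u).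
Proof.
case: t => [|t] ct ou ut; first by case: u ou ut.
pose U : pred 'I_t.+1 := fun w => w < u.
have cU : #|{: {w : 'I_t.+1 | U w}}| = u.
  rewrite card_sig; have := card_ord_in_seq (n := t.+1) (nz := iota 0 u) (iota_uniq _ _).
  rewrite size_iota => <-; first by apply: eq_card => w; rewrite !inE mem_iota.
  by apply/allP => w; rewrite mem_iota /=; lia.
have TU : TD4 {w : 'I_t.+1 | U w}.
  by apply: TD4_card (TD4_odd ou); rewrite card_ord.
(* The ingredients have orders 3, 4 and u; coprimality of t to 6 excludes torsion by 2 and 3 in
   Z_t. *)
have W := @TD4_wilson 'I_t.+1 U 'I_3 _ (TD4_odd (n := 3) isT) pointed_TD4_option3 TU.
apply: TD4_card (W _).
  by rewrite card_sum card_prod cU !card_ord mulnC.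
move=> d x; apply: ord_torsion_free => d'.
have [c2 c3] : coprime t.+1 2 /\ coprime t.+1 3.
  by move: ct; rewrite (_ : 6 = 2 * 3) // coprimeMr => /andP.
by case: d' => [|[|[|[|d']]]] // _; rewrite ?coprimen1.
Qed.

Lemma TD4_mul a b : TD4 'I_a -> TD4 'I_b -> TD4 'I_(a * b).
Proof. by move=> Ta Tb; apply: TD4_card (TD4_prod Ta Tb); rewrite card_prod !card_ord. Qed.

(** For t serves the largest number coprime to 6 with 3 t <= n. In the given range n <= 4 t fails
    only for 30 and 32, and u = n - 3 t is odd because n is even and t odd. *)
Lemma truncation_exists n : ~~ odd n -> 16 <= n -> n != 30 -> n != 32 ->
  exists t u, [/\ n = 3 * t + u, coprime t 6, odd u & u <= t].
Proof.
move=> en n16 n30 n32.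
have cop6 s r : (r == 1) || (r == 5) -> coprime (6 * s + r) 6.
  by move=> r15; rewrite coprime_sym /coprime mulnC gcdnMDl; case/orP: r15 => /eqP ->.
suff [s [r [r15 H]]] : exists s r, (r == 1) || (r == 5) /\ 3 * (6 * s + r) <= n <= 4 * (6 * s + r).
  by exists (6 * s + r), (n - 3 * (6 * s + r)); split; [lia | exact: cop6 | lia | lia].
have [f [k [r [En Ef r6]]]] : exists f k r, [/\ 3 * f <= n < 3 * f + 3, f = 6 * k + r & r < 6].
  exists (n %/ 3), (n %/ 3 %/ 6), (n %/ 3 %% 6); split; [| |exact: ltn_pmod].
    by have := divn_eq n 3; have := ltn_pmod n (isT : 0 < 3); lia.
  by rewrite mulnC -divn_eq.
have [r0|r0] := eqVneq r 0; first by exists (k - 1), 5; split=> //; lia.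
have [r5|r5] := eqVneq r 5; first by exists k, 5; split=> //; lia.
by exists k, 1; split=> //; lia.
Qed.

Theorem TD4_even n : ~~ odd n -> n != 0 -> n != 2 -> n != 6 -> TD4 'I_n.
Proof.
move=> en n0 n2 n6.
have [n16|n16] := ltnP n 16.
  have T4 : TD4 'I_4 := pointed_TD4_TD4 pointed_TD4_4.
  have /or4P : [|| n == 4, n == 8, n == 10 | (n == 12) || (n == 14)] by lia.
  case=> [/eqP ->|/eqP ->|/eqP ->|/orP [/eqP ->|/eqP ->]].
  - exact: T4.
  - exact: TD4_8.
  - exact: TD4_10.
  - exact: (TD4_mul (TD4_odd (n := 3) isT) T4).
  - exact: TD4_14.
have [->|n30] := eqVneq n 30; first exact: (TD4_mul (TD4_odd (n := 3) isT) TD4_10).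
have [->|n32] := eqVneq n 32; first exact: (TD4_mul (pointed_TD4_TD4 pointed_TD4_4) TD4_8).
have [t [u [-> ct ou ut]]] := truncation_exists en n16 n30 n32.
exact: TD4_truncation.
Qed.

(** * Factorizations from transversal designs *)

(* Row k consists of the cycles of the blocks b with b 0 = k; the layers are
   labelled by the groups 1, 2, 3, 2, 3, .., 2, 3. *)
Theorem TD4_HWP n M : 0 < n -> 2 < M -> odd M -> TD4 'I_n ->
  HWP (lexC M n) M (M * n) n 0.
Proof.
move=> n0 M3 oM [B [Bex Buniq]].
have /fin_all_exists [blk blkP] : forall kx : 'I_n * 'I_n, exists b : nat -> 'I_n,
    [/\ B b, b 0 = kx.1 & b 1 = kx.2] by move=> [k x]; exact: Bex.
pose g c k x := blk (k, x) c.
have Bg k x : B (blk (k, x)) by have [] := blkP (k, x).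
have g0 k x : blk (k, x) 0 = k by have [] := blkP (k, x).
have g1 k x : blk (k, x) 1 = x by have [] := blkP (k, x).
have gI c k : 0 < c < 4 -> injective (g c k).
  case/andP => c0 c4 x x' e; rewrite -(g1 k x) -(g1 k x').
  apply: (Buniq _ _ 0 c (Bg k x) (Bg k x')) => //; first by rewrite eq_sym -lt0n.
  by rewrite !g0.
(* As M is odd, the last layer has label 3 and meets label 1 of layer 0, so neighbouring layers
   always have different labels. *)
pose lab i := if i == 0 then 1 else if odd i then 2 else 3.
have lab4 i : 0 < lab i < 4 by rewrite /lab; do 2?case: ifP.
have labS (i : 'I_M) : lab i != lab (ordS i).
  rewrite /lab /=; have [iM|Mi] := ltnP i.+1 M.
    by rewrite modn_small //=; have [->|_] := eqVneq (i : nat) 0; [|case: (odd i)].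
  have Ei : i = M.-1 :> nat by have := ltn_ord i; lia.
  rewrite Ei prednK ?(ltnW (ltnW M3)) // modnn /=.
  by case: ifP => ?; [lia | case: ifP].
pose gi (i : nat) k := invF (gI (lab i) k (lab4 i)).
(* In row k the point y lies on one block with b 0 = k and moves to the point of the same block in
   the next group. *)
pose s k (i : 'I_M) y := g (lab (ordS i)) k (gi i k y).
have sI k i : injective (s k i).
  by move=> y y' /(gI _ _ (lab4 _)) /(can_inj (f_invF _)).
have sL i y : injective (fun k => s k i y).
  move=> k k' e; rewrite -(g0 k (gi i k y)) -(g0 k' (gi i k' y)).
  have [/andP [_ l1] /andP [_ l2]] := (lab4 i, lab4 (ordS i)).
  apply: (Buniq _ _ _ _ (Bg _ _) (Bg _ _) l1 l2 (labS i)) => //.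
  rewrite -/(g _ k (gi i k y)) -/(g _ k' (gi i k' y)).
  by rewrite /gi !f_invF.
(* A walk in row k never leaves its block, so it closes after one turn. *)
have iterE k x e (i : 'I_M) : exists j : 'I_M,
    j = (i + e) %% M :> nat /\ iter e (layer_step s k) (i, g (lab i) k x) = (j, g (lab j) k x).
  elim: e => [|e [j [Ej IH]]]; first by exists i; rewrite addn0 modn_small.
  exists (ordS j); rewrite iterS IH /layer_step /= /s /gi invF_f; split=> //.
  by rewrite Ej -addn1 modnDml addn1 addnS.
have := @layered_HWP M n s M3 sI sL pred0 0; rewrite subn0; apply; rewrite ?card0 //.
move=> k [i y] /=; apply/eqP; rewrite eqn_leq.
have M0 : 0 < M by lia.
rewrite order_le_iter //; first by apply: dvdn_leq; rewrite ?order_gt0 // (order_layer_step_dvd sI).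
have [j [Ej]] := iterE k (gi i k y) M i; rewrite /gi f_invF => ->.
have -> : j = i by apply: val_inj; rewrite /= Ej modnDr modn_small.
by rewrite f_invF.
Qed.

Theorem mainTheorem7 (n M y : nat) :
  2 <= n -> 3 <= M -> y <= n ->
  ~~ [|| (y == 1) && ~~ ((n == 2) && odd M),
         [&& y == 2, 2 < n, n %% 4 == 2 & odd M]
       | [&& y == 0, (n == 2) || (n == 6) & odd M]] ->
  HWP (lexC M n) M (M * n) (n - y) y.
Proof.
move=> n2 M3 yn; rewrite !negb_or => /and3P [H1 H2 H3].
have [Mn|] := boolP (~~ odd M || odd n).
  have [oy|ey] := boolP (odd y); last exact: HWP_balanced_even.
  by apply: HWP_balanced_odd => //; lia.
rewrite negb_or negbK => /andP [oM en]; rewrite oM in H1 H2 H3.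
have [y0|y0] := eqVneq y 0.
  by rewrite y0 subn0; apply: TD4_HWP => //; [lia | apply: TD4_even; lia].
have [En|n4] := eqVneq n 2; first by rewrite En; apply: HWP_order2 => //; lia.
have [h En] : exists h, n = 2 * h by exists n./2; lia.
(* From here y >= 2, since n > 2; for h odd and y even [H2] raises this to y >= 4. *)
rewrite En in yn n4 H1 H2 *.
have [oh|eh] := boolP (odd h); have [oy|ey] := boolP (odd y).
- by apply: HWP_h_odd_y_odd => //; lia.
- by apply: HWP_h_odd_y_even => //; lia.
- by apply: HWP_h_even_y_odd => //; lia.
- by apply: HWP_h_even_y_even => //; lia.
Qed.
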